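(* Let $(M,J)$ be a compact complex manifold of complex dimension $n$ endowed with a balanced metric $g$ with associated fundamental form $\omega$. Let $\{M_t\}_{t\in I}$, $I=(-\epsilon,\epsilon)$, $\epsilon>0$, be a differentiable family of deformations with $M_0=M$, parametrized by the $(0,1)$-vector form $\varphi(t)$ on $M$. If there exists a smooth family of balanced metrics $\{\omega_t\}_{t\in I}$ along $\{M_t\}_{t\in I}$ which coincides with $\omega$ at $t=0$, then $$\Big[\partial\big(i_{\varphi'(0)}(\omega^{n-1})\big)\Big]_{H^{n-1,n}_{\overline{\partial}}(M)}=0,$$ where $\varphi'(0)=\frac{\partial\varphi}{\partial t}\big|_{t=0}$ and $H^{n-1,n}_{\overline{\partial}}(M)$ is the Dolbeault cohomology group of $M$ of bidegree $(n-1,n)$.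
   Context: Balanced metrics: a Hermitian metric $g$ on an $n$-dimensional complex manifold with fundamental form $\omega(X,Y)=g(JX,Y)$ is balanced if $d\omega^{n-1}=0$. A Hermitian metric is identified with its fundamental form. $\mathcal{A}^{p,q}(M)$ is the space of smooth complex $(p,q)$-forms on $M$, and $d=\partial+\overline{\partial}$. Vector forms and contraction: a $(0,1)$-vector form on $M$ is an element of $\mathcal{A}^{0,1}(T^{1,0}(M))$, i.e. a smooth $(0,1)$-form with values in $T^{1,0}M$. For $\varphi=\beta\otimes V$ with $\beta$ a $(0,1)$-form and $V$ a $(1,0)$-vector field, the contraction $i_\varphi:\mathcal{A}^{p,q}(M)\to\mathcal{A}^{p-1,q+1}(M)$ is $i_\varphi(\alpha)=\beta\wedge i_V(\alpha)$, where $i_V$ is the usual interior product, extended additively to all $(0,1)$-vector forms. Families: a differentiable family $\{M_t\}_{t\in I}$ of compact complex manifolds is given by a differentiable manifold $\mathcal{M}$ and a proper differentiable surjective map $\pi:\mathcal{M}\to I$ whose Jacobian has rank equal to $\dim I$ everywhere, with fibres $\pi^{-1}(t)=M_t$ as complex manifolds. As a differentiable manifold $\mathcal{M}\simeq M\times I$, so every $M_t$ is regarded as a complex structure on the differentiable manifold underlying $M=M_0$. The family is parametrized by $\varphi(t)$ if $\varphi(t)$ is a $(0,1)$-vector form on $M$ depending smoothly on $t$, with $\varphi(0)=0$ and $\overline{\partial}\varphi(t)=\frac12[\varphi(t),\varphi(t)]$, such that the local holomorphic functions on $M_t$ are exactly the smooth complex-valued functions $f$ on open sets of $M$ with $\overline{\partial}f-i_{\varphi(t)}(\partial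 f)=0$ (for $\epsilon$ small enough). A smooth family of balanced metrics along $\{M_t\}$ means that each $\omega_t$ is the fundamental form of a balanced Hermitian metric on $M_t$ and $\omega_t$ depends smoothly on $t$. *)

(* Defs.v *)
From HB Require Import structures.
From mathcomp Require Import all_boot all_order all_algebra all_fingroup.
From mathcomp Require Import all_classical all_reals all_analysis.
From mathcomp Require Import complex.

Set Implicit Arguments.
Unset Strict Implicit.
Unset Printing Implicit Defensive.

Import Order.TTheory GRing.Theory Num.Theory.
Import numFieldNormedType.Exports.

Local Open Scope classical_set_scope.
Local Open Scope ring_scope.

Notation reC := (@complex.Re _).
Notation imC := (@complex.Im _).
Notation iC := ('i)%C.

(* Only used for open D. *)
Fixpoint Ck_on (R : realType) (V : normedModType R) (k : nat) (D : set V)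
    (f : V -> R) : Prop :=
  match k with
  | 0 => forall x, D x -> {for x, continuous f}
  | k'.+1 => (forall x, D x -> differentiable f x) /\
             (forall v : V, Ck_on k' D (fun x => 'D_v f x))
  end.

Definition smooth_on (R : realType) (V : normedModType R) (D : set V)
    (f : V -> R) : Prop := forall k, Ck_on k D f.

Definition smoothC_on (R : realType) (V : normedModType R) (D : set V)
    (f : V -> R[i]) : Prop :=
  smooth_on D (fun x => reC (f x)) /\ smooth_on D (fun x => imC (f x)).

Definition smooth_map_on (R : realType) (m m' : nat) (D : set 'rV[R]_m)
    (F : 'rV[R]_m -> 'rV[R]_m') : Prop :=
  forall j, smooth_on D (fun x => F x 0 j).

(* Derivative at x of a complex-valued function in the direction of the
   complexified tangent vector w = u + iv. *)
Definition deriveC (R : realType) (m : nat) (f : 'rV[R]_m -> R[i])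
    (w : 'rV[R[i]]_m) (x : 'rV[R]_m) : R[i] :=
  let D v := Complex ('D_v (fun y => reC (f y)) x)
                     ('D_v (fun y => imC (f y)) x) in
  D (map_mx reC w) + iC * D (map_mx imC w).

Definition cmx (R : realType) (p q : nat) (A : 'M[R]_(p, q)) : 'M[R[i]]_(p, q) :=
  map_mx (fun a : R => Complex a 0) A.

(* A k-covector on C (x) R^m is a function of k complex vectors, given as the
   rows of a k x m matrix. *)
Definition covec (R : realType) (m k : nat) := 'M[R[i]]_(k, m) -> R[i].

Definition multilinear (R : realType) (m k : nat) (a : covec R m k) : Prop :=
  forall (A B B' : 'M[R[i]]_(k, m)) (i : 'I_k) (b b' : R[i]),
    row i A = b *: row i B + b' *: row i B' ->
    row' i B = row' i A -> row' i B' = row' i A ->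
    a A = b * a B + b' * a B'.

Definition alternating (R : realType) (m k : nat) (a : covec R m k) : Prop :=
  forall (A : 'M[R[i]]_(k, m)) (i j : 'I_k), i != j -> row i A = row j A -> a A = 0.

(* Normalized so that (dx /\ dy)(e_x, e_y) = 1. *)
Definition wedge_prod (R : realType) (m k l : nat) (a : covec R m k)
    (b : covec R m l) : covec R m (k + l) :=
  fun A => ((k`! * l`!)%:R)^-1 *
    \sum_(s : 'S_(k + l)) (-1) ^+ s * (a (usubmx (row_perm s A)) *
                                      b (dsubmx (row_perm s A))).

Definition interior_prod (R : realType) (m k : nat) (v : 'rV[R[i]]_m)
    (a : covec R m k.+1) : covec R m k :=
  fun A => a (col_mx v A).

(* a^j for a 2-covector a; the degree 2 + j.*2 is convertible to (j.+1).*2. *)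
Fixpoint wedge_pow (R : realType) (m : nat) (a : covec R m 2) (j : nat) :
    covec R m j.*2 :=
  match j with
  | 0 => fun _ => 1
  | j'.+1 => wedge_prod a (@wedge_pow R m a j')
  end.
Arguments wedge_pow {R m} a j.

(* C^n = R^(n + n) with z_j = x_j + i y_j and coordinates ordered
   (x_1, .., x_n, y_1, .., y_n).  Matrices act on row vectors from the right,
   so J sends (u | v) to (- v | u). *)
Definition Jstd (R : realType) (n : nat) : 'M[R]_(n + n) :=
  block_mx 0 1%:M (- 1%:M) 0.
Arguments Jstd {R n}.

Definition zvec (R : realType) (n : nat) (j : 'I_n) : 'rV[R[i]]_(n + n) :=
  2%:R^-1 *: (delta_mx 0 (lshift n j) - iC *: delta_mx 0 (rshift n j)).

Definition zbarvec (R : realType) (n : nat) (j : 'I_n) : 'rV[R[i]]_(n + n) :=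
  2%:R^-1 *: (delta_mx 0 (lshift n j) + iC *: delta_mx 0 (rshift n j)).
Arguments zvec {R n}.
Arguments zbarvec {R n}.

Definition dz (R : realType) (n : nat) (j : 'I_n) : covec R (n + n) 1 :=
  fun A => A 0 (lshift n j) + iC * A 0 (rshift n j).

Definition dzbar (R : realType) (n : nat) (j : 'I_n) : covec R (n + n) 1 :=
  fun A => A 0 (lshift n j) - iC * A 0 (rshift n j).

Definition T10 (R : realType) (n : nat) (v : 'rV[R[i]]_(n + n)) : Prop :=
  v *m cmx Jstd = iC *: v.

Definition T01 (R : realType) (n : nat) (v : 'rV[R[i]]_(n + n)) : Prop :=
  v *m cmx Jstd = - iC *: v.

Definition proj10 (R : realType) (n : nat) (v : 'rV[R[i]]_(n + n)) :=
  2%:R^-1 *: (v - iC *: (v *m cmx Jstd)).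

Definition proj01 (R : realType) (n : nat) (v : 'rV[R[i]]_(n + n)) :=
  2%:R^-1 *: (v + iC *: (v *m cmx Jstd)).

Definition covec_type (R : realType) (n k p q : nat)
    (a : covec R (n + n) k) : Prop :=
  (p + q = k)%N /\
  forall (A : 'M[R[i]]_(k, n + n)) (S : {set 'I_k}),
    (forall i, if i \in S then T10 (row i A) else T01 (row i A)) ->
    #|S| <> p -> a A = 0.

(* Component of type (p, k - p): expand a(v_1, .., v_k) along
   v_i = proj10 v_i + proj01 v_i and keep the terms with p (1,0)-arguments. *)
Definition covec_proj (R : realType) (n k p : nat)
    (a : covec R (n + n) k) : covec R (n + n) k :=
  fun A => \sum_(S : {set 'I_k} | #|S| == p)
    a (\matrix_(i < k) (if i \in S then proj10 (row i A) else proj01 (row i A))).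

(* phi : C (x) R^(n+n) -> C (x) R^(n+n) represents the (0,1)-vector form
   \sum_j dzbar_j (x) phi(d/dzbar_j). *)
Definition covec_contraction (R : realType) (n k : nat) (phi : 'M[R[i]]_(n + n)) :
    covec R (n + n) k -> covec R (n + n) k :=
  match k with
  | 0 => fun _ _ => 0
  | k'.+1 => fun a A =>
      \sum_(j < n) wedge_prod (@dzbar R n j) (interior_prod (zbarvec j *m phi) a) A
  end.

(* chart_coord and chart_inv are meaningful only on chart_dom and on its
   image, respectively. *)
Record chart (R : realType) (m : nat) (T : topologicalType) := Chart {
  chart_dom : set T;
  chart_coord : T -> 'rV[R]_m;
  chart_inv : 'rV[R]_m -> T;
  chart_dom_open : open chart_dom;
  chart_im_open : open (chart_coord @` chart_dom);
  chart_coordK : forall p, chart_dom p -> chart_inv (chart_coord p) = p;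
  chart_coord_cont : forall p, chart_dom p -> {for p, continuous chart_coord};
  chart_inv_cont : forall x, (chart_coord @` chart_dom) x ->
    {for x, continuous chart_inv} }.

Definition chart_im (R : realType) (m : nat) (T : topologicalType)
    (c : chart R m T) : set 'rV[R]_m := chart_coord c @` chart_dom c.

Definition chart_overlap (R : realType) (m : nat) (T : topologicalType)
    (c c' : chart R m T) : set 'rV[R]_m :=
  chart_coord c @` (chart_dom c `&` chart_dom c').

Definition transition (R : realType) (m : nat) (T : topologicalType)
    (c c' : chart R m T) : 'rV[R]_m -> 'rV[R]_m :=
  fun x => chart_coord c' (chart_inv c x).

(* An atlas {chart_at p} together with the choice of a chart around each
   point p; the tangent space at p is identified with R^m through chart_at p. *)
Record smooth_atlas (R : realType) (m : nat) (T : topologicalType) := SmoothAtlas {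
  chart_at : T -> chart R m T;
  chart_at_dom : forall p, chart_dom (chart_at p) p;
  chart_at_smooth : forall p q,
    smooth_map_on (chart_overlap (chart_at p) (chart_at q))
                  (transition (chart_at p) (chart_at q)) }.

Definition holo_on (R : realType) (n : nat) (D : set 'rV[R]_(n + n))
    (f : 'rV[R]_(n + n) -> R[i]) : Prop :=
  smoothC_on D f /\ forall x, D x -> forall j, deriveC f (zbarvec j) x = 0.

Definition holo_map_on (R : realType) (n : nat) (D : set 'rV[R]_(n + n))
    (F : 'rV[R]_(n + n) -> 'rV[R]_(n + n)) : Prop :=
  forall j : 'I_n,
    holo_on D (fun x => Complex (F x 0 (lshift n j)) (F x 0 (rshift n j))).

Record complex_structure (R : realType) (n : nat) (T : topologicalType) :=
  ComplexStructure {
    atlas_of :> smooth_atlas R (n + n) T;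
    trans_holo : forall p q,
      holo_map_on (chart_overlap (chart_at atlas_of p) (chart_at atlas_of q))
                  (transition (chart_at atlas_of p) (chart_at atlas_of q)) }.

Definition same_smooth_structure (R : realType) (m : nat) (T : topologicalType)
    (S S' : smooth_atlas R m T) : Prop :=
  forall p q,
    smooth_map_on (chart_overlap (chart_at S p) (chart_at S' q))
                  (transition (chart_at S p) (chart_at S' q)) /\
    smooth_map_on (chart_overlap (chart_at S' q) (chart_at S p))
                  (transition (chart_at S' q) (chart_at S p)).

Definition same_complex_structure (R : realType) (n : nat) (T : topologicalType)
    (X X' : complex_structure R n T) : Prop :=
  forall p q,
    holo_map_on (chart_overlap (chart_at X p) (chart_at X' q))
                (transition (chart_at X p) (chart_at X' q)) /\
    holo_map_on (chart_overlap (chart_at X' q) (chart_at X p))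
                (transition (chart_at X' q) (chart_at X p)).

Definition smooth_fun (R : realType) (m : nat) (T : topologicalType)
    (S : smooth_atlas R m T) (U : set T) (f : T -> R[i]) : Prop :=
  forall q, let c := chart_at S q in
    smoothC_on (chart_coord c @` (chart_dom c `&` U)) (f \o chart_inv c).

Definition holo_fun (R : realType) (n : nat) (T : topologicalType)
    (X : complex_structure R n T) (U : set T) (f : T -> R[i]) : Prop :=
  forall q, let c := chart_at X q in
    holo_on (chart_coord c @` (chart_dom c `&` U)) (f \o chart_inv c).

(* Differential of the change of charts c -> c' at x, acting on row vectors. *)
Definition jac (R : realType) (m : nat) (T : topologicalType)
    (c c' : chart R m T) (x : 'rV[R]_m) : 'M[R]_m := jacobian (transition c c') x.

(* The value at p takes tangent vectors written in the chart chart_at p of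
   the ambient atlas. *)
Definition cform (R : realType) (m : nat) (T : topologicalType) (k : nat) :=
  T -> covec R m k.

Definition local_form (R : realType) (m : nat) (T : topologicalType) (k : nat)
    (S : smooth_atlas R m T) (c : chart R m T) (a : cform R m T k)
    (x : 'rV[R]_m) : covec R m k :=
  fun A => a (chart_inv c x) (A *m cmx (jac c (chart_at S (chart_inv c x)) x)).

Definition smooth_form (R : realType) (m : nat) (T : topologicalType) (k : nat)
    (S : smooth_atlas R m T) (a : cform R m T k) : Prop :=
  (forall p, multilinear (a p) /\ alternating (a p)) /\
  (forall q A, let c := chart_at S q in
     smoothC_on (chart_im c) (fun x => local_form S c a x A)).

Definition ext_d (R : realType) (m : nat) (T : topologicalType) (k : nat)
    (S : smooth_atlas R m T) (a : cform R m T k) : cform R m T k.+1 :=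
  fun p A => let c := chart_at S p in
    \sum_(i < k.+1) (-1) ^+ i *
      deriveC (fun x => local_form S c a x (row' i A)) (row i A) (chart_coord c p).

Definition form_pow (R : realType) (m : nat) (T : topologicalType)
    (w : cform R m T 2) (j : nat) : cform R m T j.*2 :=
  fun p => wedge_pow (w p) j.
Arguments form_pow {R m T} w j.

Definition form_of_fun (R : realType) (m : nat) (T : topologicalType)
    (f : T -> R[i]) : cform R m T 0 := fun p _ => f p.

Definition form0 (R : realType) (m : nat) (T : topologicalType) (k : nat) :
    cform R m T k := fun _ _ => 0.
Arguments form0 {R m T k}.

(* Types on a complex manifold X.  Since tangent spaces of X are identified
   with R^(n + n) through holomorphic charts, J is Jstd at every point. *)
Definition Apq (R : realType) (n : nat) (T : topologicalType) (k : nat)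
    (X : complex_structure R n T) (p q : nat) (a : cform R (n + n) T k) : Prop :=
  smooth_form X a /\ forall x, covec_type p q (a x).

Definition form_proj (R : realType) (n : nat) (T : topologicalType) (k : nat)
    (p : nat) (a : cform R (n + n) T k) : cform R (n + n) T k :=
  fun x => covec_proj p (a x).

(* On A^{p,q}, del and delbar are the (p+1,q)- and (p,q+1)-components of d. *)
Definition del (R : realType) (n : nat) (T : topologicalType) (k : nat)
    (X : complex_structure R n T) (a : cform R (n + n) T k) :
    cform R (n + n) T k.+1 :=
  fun x A => \sum_(p < k.+1) form_proj p.+1 (ext_d X (form_proj p a)) x A.

Definition delbar (R : realType) (n : nat) (T : topologicalType) (k : nat)
    (X : complex_structure R n T) (a : cform R (n + n) T k) :
    cform R (n + n) T k.+1 :=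
  fun x A => \sum_(p < k.+1) form_proj p (ext_d X (form_proj p a)) x A.

(* Dolbeault cohomology in positive total degree k.+1: the class of a
   delbar-closed (p,q)-form a is its coset modulo delbar A^{p,q-1}. *)
Definition dolbeault_cocycle (R : realType) (n : nat) (T : topologicalType)
    (k : nat) (X : complex_structure R n T) (p q : nat)
    (a : cform R (n + n) T k.+1) : Prop :=
  Apq X p q a /\ delbar X a = form0.

(* The first disjunct only matters for q = 0, where A^{p,-1} = 0. *)
Definition dolbeault_coboundary (R : realType) (n : nat) (T : topologicalType)
    (k : nat) (X : complex_structure R n T) (p q : nat)
    (a : cform R (n + n) T k.+1) : Prop :=
  a = form0 \/
  exists b : cform R (n + n) T k, [/\ (0 < q)%N, Apq X p q.-1 b & delbar X b = a].

Definition dolbeault_class (R : realType) (n : nat) (T : topologicalType)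
    (k : nat) (X : complex_structure R n T) (p q : nat)
    (a : cform R (n + n) T k.+1) : set (cform R (n + n) T k.+1) :=
  [set b | dolbeault_cocycle X p q b /\
           dolbeault_coboundary X p q (fun x A => b x A - a x A)].

(* A (0,1)-form with values in T^{1,0} is stored as the field of
   endomorphisms phi p of the complexified tangent space (v goes to
   v *m phi p) which kill T^{1,0} and take their values in T^{1,0}. *)
Definition vector_form (R : realType) (n : nat) (T : topologicalType) :=
  T -> 'M[R[i]]_(n + n).

Definition local_vf (R : realType) (n : nat) (T : topologicalType)
    (X : complex_structure R n T) (c : chart R (n + n) T)
    (phi : vector_form R n T) (x : 'rV[R]_(n + n)) : 'M[R[i]]_(n + n) :=
  let p := chart_inv c x in let c' := chart_at X p in
  cmx (jac c c' x) *m phi p *m cmx (jac c' c (chart_coord c' p)).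

Definition is_vector_form (R : realType) (n : nat) (T : topologicalType)
    (X : complex_structure R n T) (phi : vector_form R n T) : Prop :=
  (forall p v, (T10 v -> v *m phi p = 0) /\ T10 (v *m phi p)) /\
  (forall q i j, let c := chart_at X q in
     smoothC_on (chart_im c) (fun x => local_vf X c phi x i j)).

(* Coefficient phi^k_l in phi = \sum_{k,l} phi^k_l dzbar_l (x) d/dz_k. *)
Definition vf_coef (R : realType) (n : nat) (T : topologicalType)
    (X : complex_structure R n T) (c : chart R (n + n) T)
    (phi : vector_form R n T) (k l : 'I_n) (x : 'rV[R]_(n + n)) : R[i] :=
  dz k (zbarvec l *m local_vf X c phi x).

(* phi^k = \sum_l phi^k_l dzbar_l at p. *)
Definition vf_comp (R : realType) (n : nat) (T : topologicalType)
    (X : complex_structure R n T) (phi : vector_form R n T) (k : 'I_n) (p : T) :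
    covec R (n + n) 1 :=
  let c := chart_at X p in
  fun A => \sum_(l < n) vf_coef X c phi k l (chart_coord c p) * dzbar l A.

(* d phi^k / d z_i, coefficientwise, at p. *)
Definition vf_comp_dz (R : realType) (n : nat) (T : topologicalType)
    (X : complex_structure R n T) (phi : vector_form R n T) (i k : 'I_n) (p : T) :
    covec R (n + n) 1 :=
  let c := chart_at X p in
  fun A => \sum_(l < n)
    deriveC (vf_coef X c phi k l) (zvec i) (chart_coord c p) * dzbar l A.

(* (delbar phi)^k, where delbar phi = \sum_k delbar(phi^k) (x) d/dz_k. *)
Definition vf_delbar (R : realType) (n : nat) (T : topologicalType)
    (X : complex_structure R n T) (phi : vector_form R n T) (k : 'I_n) (p : T) :
    covec R (n + n) 2 :=
  let c := chart_at X p in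
  fun A => \sum_(i < n) \sum_(l < n)
    deriveC (vf_coef X c phi k l) (zbarvec i) (chart_coord c p) *
    wedge_prod (@dzbar R n i) (@dzbar R n l) A.

(* [phi, psi]^k, where for (0,1)-vector forms
   [phi, psi] = \sum_{i,k} (phi^i /\ d_i psi^k + psi^i /\ d_i phi^k) (x) d/dz_k. *)
Definition vf_bracket (R : realType) (n : nat) (T : topologicalType)
    (X : complex_structure R n T) (phi psi : vector_form R n T)
    (k : 'I_n) (p : T) : covec R (n + n) 2 :=
  fun A => \sum_(i < n)
    (wedge_prod (vf_comp X phi i p) (vf_comp_dz X psi i k p) A +
     wedge_prod (vf_comp X psi i p) (vf_comp_dz X phi i k p) A).

(* Contraction A^{p,q} -> A^{p-1,q+1}; it preserves the total degree. *)
Definition form_contraction (R : realType) (n : nat) (T : topologicalType)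
    (k : nat) (phi : vector_form R n T) (a : cform R (n + n) T k) :
    cform R (n + n) T k :=
  fun p => covec_contraction (phi p) (a p).

(* Complex structure on the tangent spaces (as seen by the atlas S) induced
   by X, whose underlying smooth structure is that of S. *)
Definition almost_cplx (R : realType) (n : nat) (T : topologicalType)
    (S : smooth_atlas R (n + n) T) (X : complex_structure R n T) (p : T) :
    'M[R]_(n + n) :=
  let c := chart_at S p in let c' := chart_at X p in
  jac c c' (chart_coord c p) *m Jstd *m jac c' c (chart_coord c' p).

Definition hermitian_metric (R : realType) (m : nat) (T : topologicalType)
    (S : smooth_atlas R m T) (J g : T -> 'M[R]_m) : Prop :=
  [/\ forall q i j, let c := chart_at S q in
        smooth_on (chart_im c) (fun x =>
          let D := jac c (chart_at S (chart_inv c x)) x in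
          (D *m g (chart_inv c x) *m D^T) i j),
      forall p, (g p)^T = g p,
      forall p (v : 'rV[R]_m), v != 0 -> 0 < (v *m g p *m v^T) 0 0
    & forall p (v w : 'rV[R]_m),
        (v *m J p) *m g p *m (w *m J p)^T = v *m g p *m w^T].

(* w(X, Y) = g(JX, Y), extended complex-bilinearly. *)
Definition fundamental_form (R : realType) (m : nat) (T : topologicalType)
    (J g : T -> 'M[R]_m) : cform R m T 2 :=
  fun p A => (row 0 A *m cmx (J p) *m cmx (g p) *m (row 1 A)^T) 0 0.

Definition balanced_metric (R : realType) (n : nat) (T : topologicalType)
    (S : smooth_atlas R (n + n) T) (J g : T -> 'M[R]_(n + n)) : Prop :=
  hermitian_metric S J g /\
  ext_d S (form_pow (fundamental_form J g) n.-1) = form0.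

Definition param_interval (R : realType) (eps : R) : set R :=
  [set t | - eps < t < eps].

(* The total space is identified with M x ]-eps, eps[, so that the fibres are
   complex structures on the smooth manifold underlying M = (T, X). *)
Definition deformation (R : realType) (n : nat) (T : topologicalType)
    (X : complex_structure R n T) (eps : R)
    (Xt : R -> complex_structure R n T) : Prop :=
  (forall t, param_interval eps t -> same_smooth_structure X (Xt t)) /\
  same_complex_structure X (Xt 0).

(* Joint smoothness in (t, x). *)
Definition smooth_family_form (R : realType) (m : nat) (T : topologicalType)
    (k : nat) (S : smooth_atlas R m T) (eps : R) (w : R -> cform R m T k) : Prop :=
  forall q A, let c := chart_at S q in
    smoothC_on (param_interval eps `*` chart_im c)
      (fun tx : (R^o * 'rV[R]_m)%type => local_form S c (w tx.1) tx.2 A).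

Definition smooth_family_vf (R : realType) (n : nat) (T : topologicalType)
    (X : complex_structure R n T) (eps : R) (phi : R -> vector_form R n T) : Prop :=
  forall q i j, let c := chart_at X q in
    smoothC_on (param_interval eps `*` chart_im c)
      (fun tx : (R^o * 'rV[R]_(n + n))%type => local_vf X c (phi tx.1) tx.2 i j).

Definition parametrized_by (R : realType) (n : nat) (T : topologicalType)
    (X : complex_structure R n T) (eps : R)
    (Xt : R -> complex_structure R n T) (phi : R -> vector_form R n T) : Prop :=
  [/\ forall t, param_interval eps t -> is_vector_form X (phi t),
      smooth_family_vf X eps phi,
      forall p, phi 0 p = 0,
      forall t, param_interval eps t -> forall k p A,
        vf_delbar X (phi t) k p A =
        2%:R^-1 * vf_bracket X (phi t) (phi t) k p A
    & forall t, param_interval eps t -> forall (U : set T) (f : T -> R[i]),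
        open U ->
        let F : cform R (n + n) T 0 := form_of_fun f in
        holo_fun (Xt t) U f <->
        smooth_fun X U f /\
        forall p, U p -> forall A,
          delbar X F p A - form_contraction (phi t) (del X F) p A = 0].

Definition dphi0 (R : realType) (n : nat) (T : topologicalType)
    (phi : R -> vector_form R n T) : vector_form R n T :=
  fun p => \matrix_(i, j)
    Complex (derive1 (fun t : R => reC (phi t p i j)) 0)
            (derive1 (fun t : R => imC (phi t p i j)) 0).

(* The metric g_t is recovered from w_t, so smoothness in t is asked of w_t. *)
Definition balanced_family (R : realType) (n : nat) (T : topologicalType)
    (X : complex_structure R n T) (eps : R)
    (Xt : R -> complex_structure R n T) (w : R -> cform R (n + n) T 2) : Prop :=
  smooth_family_form X eps w /\
  forall t, param_interval eps t ->
    exists2 g : T -> 'M[R]_(n + n),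
      balanced_metric X (almost_cplx X (Xt t)) g &
      w t = fundamental_form (almost_cplx X (Xt t)) g.

(* Main.v *)
Require Import Defs.
From mathcomp Require Import all_boot all_order all_algebra all_fingroup.
From mathcomp Require Import all_classical all_reals all_analysis.
From mathcomp Require Import complex ring.
Import Order.TTheory GRing.Theory Num.Theory.
Import numFieldNormedType.Exports.
Local Open Scope classical_set_scope.
Local Open Scope ring_scope.

(* Write Omega_t = omega_t^(n-1).  The vectors of type (0,1) for X_t are the v - phi_t v
   with v of type (0,1) for X, and omega_t vanishes on pairs of them, so by the pigeonhole
   principle Omega_t vanishes as soon as n of its 2(n-1) arguments are of this kind.
   Differentiating at t = 0 identifies the (n-2,n)-component of Omega'_0 with the
   contraction of omega^(n-1) by phi'(0).  Since every Omega_t is closed, so is Omega'_0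
   (Schwarz), and the (n-1,n)-component of d Omega'_0 = 0 says that del of this
   contraction is - delbar of the (n-1,n-1)-component of Omega'_0. *)

Set Implicit Arguments.
Unset Strict Implicit.
Unset Printing Implicit Defensive.

(** * Replacing one row of a matrix *)

Section SetRow.
Variables (K : pzRingType) (k m : nat).
Implicit Types (A : 'M[K]_(k, m)) (v : 'rV[K]_m).

(** A form stores its value at [p] in the chart chosen at [p], and this choice may jump from point
    to point. So [ext_d] uses another chart at every point, and even the smoothness of its result
    rests on the invariance of d under changes of charts, where the second derivatives of the
    transition maps cancel by symmetry. Types survive these changes because the charts of X are
    holomorphic. Components of a form are detected on matrices with rows of pure type, which makes
    row replacement the basic operation: contraction by a (0,1)-vector form is the derivation
    replacing one row v at a time by its image under phi. This derivation is the correction term in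
    the product rule for $t \mapsto \Omega_t(A - A\varphi(t))$, a function that is identically 0
    when more than n-1 rows of A have type (0,1). The v - phi_t v are of type (0,1) for X_t because
    the local coordinates f of X_t are holomorphic there: $\bar\partial f = i_{\varphi(t)}\partial
    f$ says df(v) = df(phi_t v). That the contracted form defines a class at all comes from its
    type: its delbar would have type (n-1,n+1). *)

Definition setrow A (i : 'I_k) v : 'M[K]_(k, m) :=
  \matrix_(l, j) if l == i then v 0 j else A l j.

Lemma row_setrow A i l v :
  row l (setrow A i v) = if l == i then v else row l A.
Proof. by apply/rowP => j; rewrite !mxE; case: eqP => // _; rewrite mxE. Qed.

Lemma setrow_eqP A B i v :
  row i B = v -> row' i B = row' i A -> setrow A i v = B.
Proof.
move=> /rowP hv /row'_eq hB; apply/matrixP => l j; rewrite !mxE.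
case: eqP => [->|/eqP li]; first by rewrite -hv mxE.
by rewrite hB // eq_sym.
Qed.

Lemma setrow_row A i : setrow A i (row i A) = A.
Proof. exact: setrow_eqP. Qed.

Lemma row'_setrow A i v : row' i (setrow A i v) = row' i A.
Proof.
by apply/matrixP => l j; rewrite !mxE eq_sym (negPf (neq_lift i l)).
Qed.

Lemma setrow_setrow A i v w : setrow (setrow A i v) i w = setrow A i w.
Proof. by apply/matrixP => l j; rewrite !mxE; case: eqP. Qed.

Lemma setrowC A i j v w : i != j ->
  setrow (setrow A i v) j w = setrow (setrow A j w) i v.
Proof.
move=> ij; apply/matrixP => l c; rewrite !mxE.
by case: eqP => // ->; rewrite eq_sym (negPf ij).
Qed.

Lemma row_perm_setrow (s : 'S_k) A i v :
  row_perm s (setrow A (s i) v) = setrow (row_perm s A) i v.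
Proof.
by apply/matrixP => l j; rewrite !mxE (inj_eq perm_inj).
Qed.

End SetRow.

Lemma setrow_mulmx (K : pzRingType) (k m m' : nat) (A : 'M[K]_(k, m)) i v
  (M : 'M[K]_(m, m')) : setrow A i v *m M = setrow (A *m M) i (v *m M).
Proof.
apply/matrixP => l j; rewrite !mxE; case: ifP => li;
  by under eq_bigr do rewrite mxE li; rewrite ?mxE.
Qed.

Lemma row'_setrow_lift (K : pzRingType) (k m : nat) (A : 'M[K]_(k.+1, m)) i l v :
  row' i (setrow A (lift i l) v) = setrow (row' i A) l v.
Proof. by apply/matrixP => a j; rewrite !mxE (inj_eq lift_inj). Qed.

(** * Multilinear and alternating functions of the rows *)

Section Covectors.
Variables (R : realType) (m : nat).
Implicit Type k : nat.

Lemma multilinear_setrow k (a : covec R m k) : multilinear a ->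
  forall A i b b' v w, a (setrow A i (b *: v + b' *: w)) =
    b * a (setrow A i v) + b' * a (setrow A i w).
Proof.
move=> ml A i b b' v w; apply: (ml _ _ _ i).
- by rewrite !row_setrow eqxx.
- by rewrite !row'_setrow.
- by rewrite !row'_setrow.
Qed.

Lemma multilinearI k (a : covec R m k) :
  (forall A i b b' v w, a (setrow A i (b *: v + b' *: w)) =
    b * a (setrow A i v) + b' * a (setrow A i w)) -> multilinear a.
Proof.
move=> H A B B' i b b' hA hB hB'.
rewrite -(setrow_row A i) hA H; congr (_ * a _ + _ * a _).
  exact: setrow_eqP.
exact: setrow_eqP.
Qed.

Section Multilinear.
Variables (k : nat) (a : covec R m k).
Hypothesis a_ml : multilinear a.

Lemma ml_setrowD A i v w :
  a (setrow A i (v + w)) = a (setrow A i v) + a (setrow A i w).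
Proof.
by rewrite -[v]scale1r -[w]scale1r multilinear_setrow // !scale1r !mul1r.
Qed.

Lemma ml_setrowZ A i b v : a (setrow A i (b *: v)) = b * a (setrow A i v).
Proof.
by rewrite -[b *: v]addr0 -(scale0r (0 : 'rV_m)) multilinear_setrow // mul0r addr0.
Qed.

Lemma ml_setrow0 A i : a (setrow A i 0) = 0.
Proof. by rewrite -(scale0r (0 : 'rV_m)) ml_setrowZ mul0r. Qed.

Lemma ml_row0 A i : row i A = 0 -> a A = 0.
Proof. by move=> h; rewrite -(setrow_row A i) h ml_setrow0. Qed.

Lemma ml_setrow_sum A i (I : Type) (r : seq I) (P : pred I) (c : I -> R[i])
    (v : I -> 'rV[R[i]]_m) :
  a (setrow A i (\sum_(x <- r | P x) c x *: v x)) =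
  \sum_(x <- r | P x) c x * a (setrow A i (v x)).
Proof.
apply: (big_rec2 (fun x y => a (setrow A i x) = y)); first exact: ml_setrow0.
by move=> x y1 y2 _ <-; rewrite ml_setrowD ml_setrowZ.
Qed.

Hypothesis a_alt : Defs.alternating a.

(** Polarization: the value with [v + w] in both rows vanishes, and so do two of the four terms of
    its expansion. *)
Lemma alt_setrow_swap A i j v w : i != j ->
  a (setrow (setrow A i v) j w) = - a (setrow (setrow A i w) j v).
Proof.
move=> ij; apply/eqP; rewrite -addr_eq0; apply/eqP.
have H u : a (setrow (setrow A i u) j u) = 0.
  by apply: (a_alt ij); rewrite !row_setrow !eqxx (negPf ij).
have := H (v + w).
rewrite ml_setrowD !(setrowC A _ _ ij) !ml_setrowD -!(setrowC A _ _ ij) !H.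
by rewrite addr0 add0r addrC.
Qed.

Lemma alt_xrow A i j : i != j -> a (row_perm (tperm i j) A) = - a A.
Proof.
move=> ij.
have -> : row_perm (tperm i j) A = setrow (setrow A i (row j A)) j (row i A).
  apply/matrixP => l c; rewrite !mxE; case: tpermP => [->|->|/eqP li /eqP lj].
  - by rewrite (negPf ij) eqxx.
  - by rewrite eqxx.
  - by rewrite (negPf li) (negPf lj).
rewrite alt_setrow_swap // setrow_row; congr (- a _).
exact: setrow_row.
Qed.

Lemma alt_row_perm (s : 'S_k) A : a (row_perm s A) = (-1) ^+ s * a A.
Proof.
have [ts -> dts] := prod_tpermP s.
elim: ts dts => [|t ts IH] /=; first by rewrite big_nil odd_perm1 row_perm1 mul1r.
case/andP=> dt dts; rewrite big_cons row_permM alt_xrow // IH //.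
by rewrite odd_permM odd_tperm dt /= signrN mulNr.
Qed.

End Multilinear.

(** Removing [i] from the source and [s i] from the target leaves the injection [f] of the remaining
    [k] indices, hence a permutation. *)
Lemma lift_perm_exists k (s : 'S_k.+1) i j : s i = j ->
  exists t : 'S_k, s = lift_perm i j t.
Proof.
move=> <-; pose f l := odflt l (unlift (s i) (s (lift i l))).
have fK l : lift (s i) (f l) = s (lift i l).
  rewrite /f; have := neq_lift i l.
  by rewrite -(can_eq (permK s)) => /unlift_some[] ? ? ->.
have f_inj : injective f.
  move=> l l' e; apply: (@lift_inj _ i); apply: (@perm_inj _ s).
  by rewrite -!fK e.
exists (perm f_inj); apply/permP => l.
case: (unliftP i l) => [l'|] ->; rewrite ?lift_perm_id //.
by rewrite lift_perm_lift permE fK.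
Qed.

(* The transposition (i l) maps row' l A to a permutation of row' i A, of sign
   (-1)^(i + l + 1). *)
Lemma alt_row'_cancel k (a : covec R m k) (a_ml : multilinear a)
    (a_alt : Defs.alternating a) (A : 'M[R[i]]_(k.+1, m)) i l :
  i != l -> row i A = row l A ->
  (-1) ^+ i * a (row' i A) + (-1) ^+ l * a (row' l A) = 0.
Proof.
move=> il hA.
have [s hs] := lift_perm_exists (tpermL i l).
have hA' : row_perm (tperm i l) A = A.
  apply/row_matrixP => c; have -> : row c (row_perm (tperm i l) A) = row (tperm i l c) A.
    by apply/rowP => j; rewrite !mxE.
  by case: tpermP => [->|->|].
have -> : row' i A = row_perm s (row' l A).
  by rewrite -{1}hA' hs; apply/matrixP => x j; rewrite !mxE lift_perm_lift.
rewrite alt_row_perm // mulrA -[(-1) ^+ i]signr_odd -[(-1) ^+ l]signr_odd.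
rewrite -signr_addb.
(* A transposition is odd, and the sign of a lifted permutation is that of [s] times (-1)^(i + l);
   this fixes the sign of [s]. *)
have := odd_tperm i l; rewrite hs odd_lift_perm il.
rewrite -[LHS]addbC; case: (odd i); case: (odd l); case: (odd_perm s) => //= _;
  by rewrite ?expr1 ?expr0 ?mul1r ?mulN1r ?addrN ?addNr.
Qed.

End Covectors.

Lemma eq_oppr0 (R : realType) (x : R[i]) : x = - x -> x = 0.
Proof.
by move/eqP; rewrite -addr_eq0 -mulr2n -mulr_natl mulf_eq0 pnatr_eq0 /= => /eqP.
Qed.

(** * Wedge products and powers *)

Section Wedge.
Variables (R : realType) (m k l : nat).
Implicit Types (A : 'M[R[i]]_(k + l, m)) (v : 'rV[R[i]]_m).

Lemma usubmx_setrowl A i v :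
  usubmx (setrow A (lshift l i) v) = setrow (usubmx A) i v.
Proof. by apply/matrixP => x j; rewrite !mxE (inj_eq (@lshift_inj _ _)). Qed.

Lemma usubmx_setrowr A i v : usubmx (setrow A (rshift k i) v) = usubmx A.
Proof. by apply/matrixP => x j; rewrite !mxE eq_lrshift. Qed.

Lemma dsubmx_setrowl A i v : dsubmx (setrow A (lshift l i) v) = dsubmx A.
Proof. by apply/matrixP => x j; rewrite !mxE eq_rlshift. Qed.

Lemma dsubmx_setrowr A i v :
  dsubmx (setrow A (rshift k i) v) = setrow (dsubmx A) i v.
Proof. by apply/matrixP => x j; rewrite !mxE (inj_eq (@rshift_inj _ _)). Qed.

Lemma wedge_multilinear (a : covec R m k) (b : covec R m l) :
  multilinear a -> multilinear b -> multilinear (wedge_prod a b).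
Proof.
move=> aml bml; apply: multilinearI => A i c c' v w; rewrite /wedge_prod.
rewrite (mulrCA c) (mulrCA c') -mulrDr; congr (_ * _).
rewrite !mulr_sumr -big_split /=; apply: eq_bigr => s _.
have E u : row_perm s (setrow A i u) = setrow (row_perm s A) (s^-1%g i) u.
  by rewrite -{1}(permKV s i) row_perm_setrow.
rewrite !E; case: (split_ordP (s^-1%g i)) => j ->.
  rewrite !usubmx_setrowl !dsubmx_setrowl (multilinear_setrow aml).
  by rewrite mulrDl mulrDr -!mulrA; congr (_ + _); rewrite mulrCA.
rewrite !usubmx_setrowr !dsubmx_setrowr (multilinear_setrow bml).
by rewrite 2!mulrDr (mulrCA _ c) (mulrCA _ c') (mulrCA _ c) (mulrCA _ c').
Qed.

(** Reindexing the sum by composition with [tperm i j], which fixes a matrix with equal rows [i] and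
    [j], turns the sum into its opposite. *)
Lemma wedge_alternating (a : covec R m k) (b : covec R m l) :
  Defs.alternating (wedge_prod a b).
Proof.
move=> A i j ij hA; rewrite /wedge_prod.
set S := (X in _ * X); suff -> : S = 0 by rewrite mulr0.
apply: eq_oppr0; rewrite /S [LHS](reindex_inj (@mulIg _ (tperm i j))) /=.
rewrite -sumrN; apply: eq_bigr => s _.
rewrite row_permM; have -> : row_perm (tperm i j) A = A.
  apply/row_matrixP => c; rewrite -[row c (row_perm _ A)]/(row c _).
  have -> : row c (row_perm (tperm i j) A) = row (tperm i j c) A.
    by apply/rowP => x; rewrite !mxE.
  by case: tpermP => [->|->|].
by rewrite odd_permM odd_tperm ij addbT signrN mulNr.
Qed.

End Wedge.

Section WedgePow.
Variables (R : realType) (m : nat) (w : covec R m 2).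

Lemma wedge_pow_multilinear j : multilinear w -> multilinear (wedge_pow w j).
Proof.
move=> wml; elim: j => [|j IH] /=; first by move=> A B B' [].
exact: (wedge_multilinear wml IH).
Qed.

Lemma wedge_pow_alternating j : Defs.alternating (wedge_pow w j).
Proof.
case: j => [|j] /=; first by move=> A [].
exact: (@wedge_alternating R m 2 j.*2).
Qed.

(* Pigeonhole: more than j of the 2j arguments lie in L, so some factor w gets two
   of them. *)
Lemma wedge_pow_isotropic (L : 'rV[R[i]]_m -> Prop) j (S : {set 'I_j.*2}) A :
  (forall B, L (row 0 B) -> L (row 1 B) -> w B = 0) ->
  (forall i, i \in S -> L (row i A)) -> (j < #|S|)%N -> wedge_pow w j A = 0.
Proof.
move=> wL; elim: j S A => [|j IH] S A /= SL hS.
  by have := max_card (mem S); rewrite card_ord leqNgt hS.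
rewrite /wedge_prod big1 ?mulr0 // => s _.
set B := row_perm s A.
have LB i : s i \in S -> L (row i B).
  move=> iS; have -> : row i B = row (s i) A by apply/rowP => c; rewrite !mxE.
  exact: SL.
have Lu (i : 'I_2) : s (lshift j.*2 i) \in S -> L (row i (usubmx B)).
  move=> iS; have -> : row i (usubmx B) = row (lshift j.*2 i) B.
    by apply/rowP => c; rewrite !mxE.
  exact: LB.
(* The elements of [S] are counted by the slot they reach: the two arguments of the factor [w], then
   the [j.*2] arguments of the remaining power. *)
have cS : #|S| = ((s (lshift j.*2 (0%R : 'I_2)) \in S) + (s (lshift j.*2 (1%R : 'I_2)) \in S)
    + #|[set i | s (rshift 2 i) \in S]%SET|)%N.
  rewrite -sum1_card big_mkcond (reindex_inj (@perm_inj _ s)) /=.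
  rewrite (@big_split_ord _ _ _ 2 j.*2) /= !big_ord_recl big_ord0 addn0.
  rewrite -[#|[set i | _]%SET|]sum1_card [in RHS]big_mkcond /=.
  congr (_ + _ + _)%N; try (by case: ifP).
    by rewrite (_ : lift ord0 ord0 = 1%R :> 'I_2); [case: ifP | apply: val_inj].
  by apply: eq_bigr => i _; rewrite finset.in_set.
(* Either [w] receives two vectors of [L] and vanishes, or it uses up at most one, and more than [j]
   are left for the induction hypothesis. *)
case: (boolP ((s (lshift j.*2 (0%R : 'I_2)) \in S) && (s (lshift j.*2 (1%R : 'I_2)) \in S))).
  by case/andP => h0 h1; rewrite wL ?mul0r ?mulr0 //; apply: Lu.
move=> h01; rewrite (IH [set i | s (rshift 2 i) \in S]%SET) ?mulr0 //.
  move=> i; rewrite finset.in_set => /LB; congr L.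
  by apply/rowP => c; rewrite !mxE.
move: hS; rewrite cS; move: h01; case: (_ \in S); case: (_ \in S) => //= _;
  rewrite ?add0n ?addn0 ?add1n ?ltnS //.
exact: ltnW.
Qed.

End WedgePow.

(** Linearity of [proj10] and [proj01] at once: [h] stands for 1/2, [c] for -i or i, and [x], [y]
    for the images of [v], [w] under J. *)
Lemma scale_comb (K : comPzRingType) m (h c b b' : K) (x y v w : 'rV[K]_m) :
  h *: (b *: v + b' *: w + c *: (b *: x + b' *: y)) =
  b *: (h *: (v + c *: x)) + b' *: (h *: (w + c *: y)).
Proof.
apply/rowP => j; rewrite !mxE.
by move: (v 0 j) (w 0 j) (x 0 j) (y 0 j) => *; ring.
Qed.

(** * Vectors of type (1,0) and (0,1), and contraction by a vector form *)

Section Contraction.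
Variables (R : realType) (n : nat).
Local Notation m := (n + n)%N.
Local Notation J := (cmx (@Jstd R n)).
Implicit Types v w : 'rV[R[i]]_m.

Lemma iC2 : (iC : R[i]) * iC = -1.
Proof. by apply/eqP; rewrite eq_complex /= !mul0r !mulr0 !mul1r sub0r addr0 oppr0 !eqxx. Qed.

Lemma mul_block_Jstd v : v *m J = row_mx (- rsubmx v) (lsubmx v).
Proof.
have -> : J = block_mx 0 1%:M (- 1%:M) 0.
  rewrite /cmx /Jstd map_block_mx; congr block_mx; apply/matrixP => i j;
    rewrite !mxE //; case: eqP => _ //=; apply/eqP; rewrite eq_complex /= ?oppr0 ?eqxx //.
by rewrite -{1}[v]hsubmxK mul_row_block !mulmx0 mulmx1 mulmxN mulmx1 add0r addr0.
Qed.

Lemma J2 v : v *m J *m J = - v.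
Proof.
by rewrite !mul_block_Jstd !row_mxKl !row_mxKr -opp_row_mx hsubmxK.
Qed.

Lemma proj10_T10 v : T10 (proj10 v).
Proof.
rewrite /T10 /proj10 -scalemxAl mulmxBl -scalemxAl J2 scalerA [iC * _]mulrC -scalerA.
by congr (_ *: _); rewrite scalerN opprK scalerBr scalerA iC2 scaleN1r opprK addrC.
Qed.

Lemma proj01_T01 v : T01 (proj01 v).
Proof.
rewrite /T01 /proj01 -scalemxAl mulmxDl -scalemxAl J2 scalerA [- iC * _]mulrC -scalerA.
congr (_ *: _).
by rewrite scalerN scalerDr scalerA mulNr iC2 opprK scale1r scaleNr addrC.
Qed.

Lemma half2 (V : lmodType R[i]) (v : V) : 2%:R^-1 *: (v + v) = v.
Proof.
by rewrite -mulr2n -[v *+ 2]scaler_nat scalerA mulVf ?scale1r // pnatr_eq0.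
Qed.

Lemma projD v : proj10 v + proj01 v = v.
Proof.
rewrite /proj10 /proj01 -scalerDr addrACA addNr addr0; exact: half2.
Qed.

Lemma proj10_id v : T10 v -> proj10 v = v.
Proof.
by move=> h; rewrite /proj10 h scalerA iC2 scaleN1r opprK half2.
Qed.

Lemma proj01_id v : T01 v -> proj01 v = v.
Proof.
by move=> h; rewrite /proj01 h scalerA mulrN iC2 opprK scale1r half2.
Qed.

Lemma proj10_0 v : T01 v -> proj10 v = 0.
Proof.
by move=> h; rewrite /proj10 h scalerA mulrN iC2 opprK scale1r subrr scaler0.
Qed.

Lemma proj01_0 v : T10 v -> proj01 v = 0.
Proof.
by move=> h; rewrite /proj01 h scalerA iC2 scaleN1r subrr scaler0.
Qed.

Lemma proj10_comb b b' v w : proj10 (b *: v + b' *: w) = b *: proj10 v + b' *: proj10 w.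
Proof.
by rewrite /proj10 mulmxDl -!scalemxAl -!scaleNr; exact: (scale_comb _ (- iC)).
Qed.

Lemma proj01_comb b b' v w : proj01 (b *: v + b' *: w) = b *: proj01 v + b' *: proj01 w.
Proof.
by rewrite /proj01 mulmxDl -!scalemxAl; exact: (scale_comb _ iC).
Qed.

Lemma proj01E v : proj01 v = \sum_(j < n) (@dzbar R n j v) *: zbarvec j.
Proof.
apply/rowP => c; rewrite summxE /proj01 mul_block_Jstd.
rewrite -{1}[v]hsubmxK -[iC *: row_mx _ _]/(iC *: _) scale_row_mx add_row_mx scale_row_mx.
have h i (F : 'I_n -> R[i]) : (forall j, j != i -> F j = 0) -> \sum_j F j = F i.
  by move=> hF; rewrite (bigD1 i) //= big1 ?addr0.
case: (split_ordP c) => i ->.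
  rewrite row_mxEl (h i) => [|j ji]; rewrite !mxE /= ?eqxx ?eq_lshift ?eq_lrshift.
    by rewrite /dzbar !mulrb; ring.
  by rewrite [i == j]eq_sym (negPf ji) !mulrb; ring.
rewrite row_mxEr (h i) => [|j ji]; rewrite !mxE /= ?eqxx ?eq_rshift ?eq_rlshift.
  rewrite /dzbar !mulrb add0r mulr1; have := iC2; set x := iC => hx.
  transitivity (2%:R^-1 * (v 0 (lshift n i) * x - (x * x) * v 0 (rshift n i))); last by ring.
  by rewrite hx; ring.
by rewrite [i == j]eq_sym (negPf ji) !mulrb; ring.
Qed.

Lemma T01_dz v : (forall j, @dz R n j v = 0) -> T01 v.
Proof.
rewrite /T01 mul_block_Jstd => h; rewrite -{3}[v]hsubmxK scale_row_mx.
have e j : v 0 (lshift n j) = - (iC * v 0 (rshift n j)).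
  by apply/eqP; rewrite -addr_eq0; apply/eqP; apply: h.
congr row_mx; apply/rowP => j; rewrite !mxE e.
  by rewrite mulrN mulNr opprK mulrA iC2 mulN1r.
by rewrite mulNr.
Qed.

(** [lift_perm 0 i] maps the permutations of [k] letters bijectively onto this set. The number k!
    cancels the normalization of the wedge product of a 1-covector with a [k]-covector. *)
Lemma card_perm_at k (i : 'I_k.+1) : #|[set s : 'S_k.+1 | s 0 == i]%SET| = k`!.
Proof.
rewrite -card_Sn -(@card_imset _ _ (lift_perm 0 i)).
  apply: eq_card => s; rewrite finset.in_set; apply/eqP/imsetP => [h|[t _ ->]].
    by have [t ->] := lift_perm_exists h; exists t; rewrite ?inE.
  by rewrite lift_perm_id.
move=> s t /permP h; apply/permP => j; apply: (@lift_inj _ i).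
by have := h (lift 0 j); rewrite !lift_perm_lift.
Qed.

(** Contraction is a derivation on arguments. In the term of a permutation [s], the sum over j of
    dzbar_j(v) d/dzbar_j rebuilds the (0,1)-part of v = row [s 0], and [phi] kills the (1,0)-part;
    putting the rows back in order produces a second sign that cancels the first. *)
Lemma covec_contractionE k (phi : 'M[R[i]]_m) (a : covec R m k) A :
  multilinear a -> Defs.alternating a -> (forall v, T10 v -> v *m phi = 0) ->
  covec_contraction phi a A = \sum_i a (setrow A i (row i A *m phi)).
Proof.
case: k a A => [|k] a A aml aalt phi0 /=; first by rewrite big_ord0.
rewrite /wedge_prod /= -mulr_sumr exchange_big /=.
rewrite -[(1`!)%N]/1%N mul1n.
pose A1 : 'M[R[i]]_(1 + k, n + n) := A.
have H (s : 'S_k.+1) : \sum_(j < n) (-1) ^+ s * (dzbar j (usubmx (@row_perm _ (1 + k) _ s A1)) *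
     interior_prod (zbarvec j *m phi) a (dsubmx (@row_perm _ (1 + k) _ s A1))) =
     a (setrow A (s 0) (row (s 0) A *m phi)).
  rewrite -mulr_sumr /interior_prod.
  set D := dsubmx _.
  have cE v : col_mx v D = setrow (col_mx 0 D : 'M[R[i]]_(1 + k, n + n)) (lshift k 0) v.
    apply/matrixP => x j; rewrite [RHS]mxE; case: (split_ordP x) => y ->.
      by rewrite !col_mxEu ord1 eqxx.
    by rewrite !col_mxEd eq_rlshift.
  under eq_bigr do rewrite cE.
  rewrite -(@ml_setrow_sum _ _ _ a) // -cE.
  under eq_bigr do rewrite scalemxAl.
  rewrite -mulmx_suml -proj01E.
  have -> : usubmx (@row_perm _ (1 + k) _ s A1) = row (s 0) A.
    by apply/rowP => j; rewrite !mxE; congr (A (s _) _); apply: val_inj.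
  have -> : proj01 (row (s 0) A) *m phi = row (s 0) A *m phi.
    by rewrite -{2}[row (s 0) A]projD mulmxDl (phi0 _ (proj10_T10 _)) add0r.
  have -> : col_mx (row (s 0) A *m phi) D = row_perm s (setrow A (s 0) (row (s 0) A *m phi)).
    rewrite row_perm_setrow; apply/matrixP => x j; rewrite [RHS]mxE.
    case: (split_ordP (x : 'I_(1 + k))) => y ->.
      rewrite col_mxEu ord1; case: eqP => // h; case: h; exact: val_inj.
    rewrite col_mxEd; case: eqP => [/(congr1 val)|_] //.
    by rewrite !mxE.
  by rewrite alt_row_perm // mulrA -expr2 sqrr_sign mul1r.
under eq_bigr do rewrite H.
(* The permutations are grouped by the row fed to the 1-covectors dzbar_j; the k! members of a group
   contribute equally. *)
rewrite (partition_big (fun s : 'S_k.+1 => s 0) xpredT) //= mulr_sumr.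
apply: eq_bigr => i _.
rewrite (eq_bigr (fun=> a (setrow A i (row i A *m phi)))); last by move=> s /eqP->.
rewrite sumr_const -[X in _ * X]mulr_natl mulrA.
have -> : #|[pred s : 'S_k.+1 | s 0 == i]| = k`!.
  by rewrite -(card_perm_at i); apply: eq_card => s; rewrite finset.in_set.
by rewrite mulVf ?mul1r // pnatr_eq0 -lt0n fact_gt0.
Qed.

End Contraction.

(** * Components of a covector by type *)

Section Types.
Variables (R : realType) (n : nat).
Implicit Types k p : nat.
Local Notation rowM k := ('M[R[i]]_(k, n + n)).

Definition typed k (A : rowM k) (S : {set 'I_k}) : Prop :=
  forall i, if i \in S then T10 (row i A) else T01 (row i A).

Definition proj_rows k (S : {set 'I_k}) (A : rowM k) : rowM k :=
  \matrix_(i < k) (if i \in S then proj10 (row i A) else proj01 (row i A)).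

Lemma row_proj_rows k (S : {set 'I_k}) (A : rowM k) i :
  row i (proj_rows S A) = if i \in S then proj10 (row i A) else proj01 (row i A).
Proof. exact: rowK. Qed.

Lemma proj_rows_typed k (S : {set 'I_k}) (A : rowM k) : typed (proj_rows S A) S.
Proof.
move=> i; rewrite row_proj_rows; case: (i \in S); first exact: proj10_T10.
exact: proj01_T01.
Qed.

Lemma proj_rows_id k (S : {set 'I_k}) (A : rowM k) : typed A S -> proj_rows S A = A.
Proof.
move=> h; apply/row_matrixP => i; rewrite row_proj_rows; have := h i.
by case: (i \in S) => hi; rewrite ?proj10_id ?proj01_id.
Qed.

Lemma proj_rows_setrow k (S : {set 'I_k}) (A : rowM k) i v :
  proj_rows S (setrow A i v) =
  setrow (proj_rows S A) i (if i \in S then proj10 v else proj01 v).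
Proof.
apply/row_matrixP => l; rewrite row_proj_rows !row_setrow.
by case: eqP => [->|_]; rewrite ?row_proj_rows.
Qed.

Lemma covec_projE k p (a : covec R (n + n) k) A :
  covec_proj p a A = \sum_(S : {set 'I_k} | #|S| == p) a (proj_rows S A).
Proof. by []. Qed.

(** If [S'] differs from [S] at [i], then row [i] is projected onto the type opposite to its own and
    becomes 0; only the term of [S] itself can survive. *)
Lemma covec_proj_typed k p (a : covec R (n + n) k) A S : multilinear a ->
  typed A S -> covec_proj p a A = if #|S| == p then a A else 0.
Proof.
move=> aml hA; have H S' : S' != S -> a (proj_rows S' A) = 0.
  move=> SS; have [i hi] : exists i, (i \in S') != (i \in S).
    apply/existsP; apply: contraR SS; rewrite negb_exists => /forallP h.
    by apply/eqP/setP => i; apply/eqP; have := h i; rewrite negbK.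
  apply: (ml_row0 aml (i := i)); rewrite row_proj_rows; have := hA i.
  by move: hi; case: (i \in S'); case: (i \in S) => // _ h; rewrite ?proj10_0 ?proj01_0.
rewrite covec_projE; case: ifP => hS.
  rewrite (bigD1 S) //= big1 ?addr0 ?proj_rows_id // => S' /andP[_]; exact: H.
by rewrite big1 // => S' hS'; apply: H; apply: contraFneq hS => <-.
Qed.

Lemma covec_proj_ext k p (a b : covec R (n + n) k) :
  (forall A S, typed A S -> #|S| = p -> a A = b A) ->
  covec_proj p a = covec_proj p b.
Proof.
move=> h; apply/funext => A; apply: eq_bigr => S /eqP hS; apply: (h _ S) => //.
exact: proj_rows_typed.
Qed.

Lemma covec_proj0 k p (a : covec R (n + n) k) :
  (forall A S, typed A S -> #|S| = p -> a A = 0) ->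
  covec_proj p a = fun=> 0.
Proof.
move=> h; apply/funext => A; apply: big1 => S /eqP hS; apply: (h _ S) => //.
exact: proj_rows_typed.
Qed.

Lemma covec_proj_multilinear k p (a : covec R (n + n) k) :
  multilinear a -> multilinear (covec_proj p a).
Proof.
move=> aml; apply: multilinearI => A i b b' v w.
rewrite !covec_projE !mulr_sumr -big_split /=; apply: eq_bigr => S _.
rewrite !proj_rows_setrow -multilinear_setrow //; congr (a (setrow _ _ _)).
by case: (i \in S); rewrite ?proj10_comb ?proj01_comb.
Qed.

(** The transposition of [i] and [j] acts on the subsets [S], preserving their cardinality; since
    rows [i] and [j] agree, it exchanges these two rows of the projected matrices. *)
Lemma covec_proj_alternating k p (a : covec R (n + n) k) :
  multilinear a -> Defs.alternating a -> Defs.alternating (covec_proj p a).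
Proof.
move=> aml aalt A i j ij hA; apply: eq_oppr0; rewrite {1}covec_projE.
pose f (S : {set 'I_k}) : {set 'I_k} := tperm i j @^-1: S.
have fK : involutive f by move=> S; apply/setP => x; rewrite !finset.inE tpermK.
rewrite (reindex_inj (can_inj fK)) covec_projE -sumrN /=.
apply: eq_big => [S|S _].
  by rewrite card_preimset //; apply: perm_inj.
rewrite -(alt_xrow aml aalt _ ij); congr (a _); apply/row_matrixP => x.
rewrite row_proj_rows finset.inE.
have -> : row x (row_perm (tperm i j) (proj_rows S A)) = row (tperm i j x) (proj_rows S A).
  by apply/rowP => c; rewrite !mxE.
rewrite row_proj_rows; have -> // : row (tperm i j x) A = row x A.
by case: tpermP => [->|->|].
Qed.

Lemma covec_proj_type k p (a : covec R (n + n) k) : multilinear a ->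
  (p <= k)%N -> covec_type p (k - p) (covec_proj p a).
Proof.
move=> aml pk; split; first by rewrite subnKC.
move=> A S hA hS; rewrite (covec_proj_typed p aml (S := S)) //.
by case: eqP => // h; case: hS.
Qed.

(** The vectors of type (0,1) form a space of dimension [n], so more than [n] of them are dependent:
    a nonzero [u] in the left kernel of their coordinate matrix [C] gives the relation. *)
Lemma alt_T01_eq0 k (a : covec R (n + n) k) (aml : multilinear a)
    (aalt : Defs.alternating a) A (S : {set 'I_k}) :
  (forall i, i \in S -> T01 (row i A)) -> (n < #|S|)%N -> a A = 0.
Proof.
move=> hS nS.
pose C : 'M[R[i]]_(#|S|, n) := \matrix_(x, j) dzbar j (row (enum_val x) A).
have : kermx C != 0.
  rewrite kermx_eq0 -row_leq_rank -ltnNge; exact: leq_ltn_trans (rank_leq_col C) nS.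
case/rowV0Pn => u /sub_kermxP uC /rV0Pn[x0 ux0].
have hrow x : row (enum_val x) A = \sum_(j < n) C x j *: zbarvec j.
  rewrite -[LHS]proj01_id; last exact/hS/enum_valP.
  by rewrite proj01E; apply: eq_bigr => j _; rewrite mxE.
have : \sum_(x < #|S|) u 0 x *: row (enum_val x) A = 0.
  under eq_bigr do rewrite hrow scaler_sumr.
  rewrite exchange_big big1 //= => j _.
  under eq_bigr do rewrite scalerA.
  rewrite -scaler_suml; have /rowP/(_ j) := uC; rewrite !mxE => ->.
  by rewrite scale0r.
(* The relation is inserted in the row of [x0]: every term other than that of [x0] repeats a row and
   vanishes, and the coefficient of [x0] is nonzero. *)
rewrite (bigD1 x0) //= => /(congr1 (fun v => a (setrow A (enum_val x0) v))).
rewrite ml_setrowD // ml_setrowZ // setrow_row ml_setrow_sum // ml_setrow0 //.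
rewrite [X in _ + X]big1 ?addr0; first by move/eqP; rewrite mulf_eq0 (negPf ux0) => /eqP.
move=> x xx0; rewrite (aalt _ (enum_val x0) (enum_val x)) ?mulr0 //.
  by rewrite eq_sym (inj_eq enum_val_inj).
by rewrite !row_setrow eqxx (inj_eq enum_val_inj) (negPf xx0).
Qed.

End Types.

(** * Smooth real functions on open sets *)

Lemma near_open (T : topologicalType) (W : Type) (D : set T) (f g : T -> W) x :
  open D -> D x -> (forall y, D y -> f y = g y) -> \forall y \near x, f y = g y.
Proof.
by move=> oD Dx fg; apply: filterS fg _; exact: open_nbhs_nbhs.
Qed.

Section NearEq.
Variables (R : realType) (V W : normedModType R).
Implicit Types f g : V -> W.

(** The first-order expansion of [f] at [x] is also one of [g], and [diff_unique] identifies the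
    differentials. *)
Lemma near_eq_differentiable f g x :
  (\forall y \near x, f y = g y) -> differentiable f x -> differentiable g x.
Proof.
move=> fg df.
have gx : g x = f x by rewrite (nbhs_singleton fg).
have H : g \o shift x = cst (g x) + 'd f x +o_ 0 id.
  apply/eqaddoP => _/posnumP[e].
  have /eqaddoP/(_ e%:num)/(_ [gt0 of e%:num]) := diff_locally df.
  have : \forall h \near 0, f (h + x) = g (h + x).
    by move: fg; rewrite (near_shift 0 x); apply: filterS => h; rewrite /= subr0.
  apply: filterS2 => h e1 /=; rewrite -![(_ - _ : V -> W) _]/(_ - _) /=.
  by rewrite /= e1 gx.
have dg : 'd g x = 'd f x :> (V -> W).
  by apply: diff_unique H; exact: diff_continuous.
apply/diff_locallyP; rewrite dg; split => //; exact: diff_continuous.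
Qed.

Lemma near_eq_continuous f g x :
  (\forall y \near x, f y = g y) -> {for x, continuous f} -> {for x, continuous g}.
Proof.
move=> fg fx; rewrite /prop_for /continuous_at -(nbhs_singleton fg).
by apply: cvg_trans fx; apply: near_eq_cvg.
Qed.

End NearEq.

Section Ck.
Variables (R : realType) (V : normedModType R).
Implicit Types (f g : V -> R) (D : set V).

Lemma Ck_on_congr k D f g : open D -> (forall x, D x -> f x = g x) ->
  Ck_on k D f -> Ck_on k D g.
Proof.
move=> oD; elim: k f g => [|k IH] f g fg /=.
  by move=> cf x Dx; apply: near_eq_continuous (cf _ Dx); exact: near_open Dx fg.
case=> df Df; split => [x Dx|v].
  by apply: near_eq_differentiable (df _ Dx); exact: near_open Dx fg.
apply: IH (Df v) => x Dx; apply: near_eq_derive; exact: near_open Dx fg.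
Qed.

Lemma smooth_on_congr D f g : open D -> (forall x, D x -> f x = g x) ->
  smooth_on D f -> smooth_on D g.
Proof. by move=> oD fg sf k; apply: Ck_on_congr (sf k). Qed.

Lemma smooth_on_derive D f v : smooth_on D f -> smooth_on D (fun x => 'D_v f x).
Proof. by move=> sf k; have [_] := sf k.+1; exact. Qed.

Lemma smooth_on_differentiable D f x : smooth_on D f -> D x -> differentiable f x.
Proof. by move=> sf; have [df _] := sf 1%N; exact: df. Qed.

Lemma smooth_on_continuous D f x : smooth_on D f -> D x -> {for x, continuous f}.
Proof. by move=> sf; exact: (sf 0%N). Qed.

Lemma smooth_on_cst D (c : R) : smooth_on D (fun=> c).
Proof.
move=> k; elim: k c => [|k IH] c /=; first by move=> x _; exact: cst_continuous.
split => [x _|v]; first exact: differentiable_cst.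
by have := IH 0; congr Ck_on; apply/funext => x; rewrite derive_cst.
Qed.

Lemma Ck_on_add k D f g : open D -> Ck_on k D f -> Ck_on k D g ->
  Ck_on k D (fun x => f x + g x).
Proof.
move=> oD; elim: k f g => [|k IH] f g /=.
  by move=> cf cg x Dx; apply: continuousD; [exact: cf|exact: cg].
move=> [df Df] [dg Dg]; split => [x Dx|v].
  by apply: differentiableD; [exact: df|exact: dg].
apply: Ck_on_congr oD _ (IH _ _ (Df v) (Dg v)).
move=> x Dx; apply/esym; apply: deriveD; apply: diff_derivable;
  [exact: df|exact: dg].
Qed.

Lemma smooth_on_add D f g : open D -> smooth_on D f -> smooth_on D g ->
  smooth_on D (fun x => f x + g x).
Proof. by move=> oD sf sg k; apply: Ck_on_add (sf k) (sg k). Qed.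

Lemma smooth_on_mul D f g : open D -> smooth_on D f -> smooth_on D g ->
  smooth_on D (fun x => f x * g x).
Proof.
move=> oD sf sg k; elim: k f g sf sg => [|k IH] f g sf sg /=.
  by move=> x Dx; apply: continuousM; apply: (smooth_on_continuous (D := D)).
split => [x Dx|v].
  by apply: differentiableM; apply: (smooth_on_differentiable (D := D)).
apply: Ck_on_congr oD _ (Ck_on_add oD (IH _ _ sf (smooth_on_derive v sg))
  (IH _ _ sg (smooth_on_derive v sf))) => x Dx.
apply/esym; apply: deriveM; apply: diff_derivable;
  exact: (smooth_on_differentiable (D := D)).
Qed.

Lemma smooth_on_opp D f : open D -> smooth_on D f -> smooth_on D (fun x => - f x).
Proof.
move=> oD sf; apply: smooth_on_congr oD _ (smooth_on_mul oD (smooth_on_cst _ (-1)) sf).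
by move=> x _; rewrite mulN1r.
Qed.

(* Two applications of the mean value theorem to the second difference of f, in
   the direction u and then v. *)
Lemma second_difference f D (x u v : V) (h : R) : 0 < h ->
  (forall s t, 0 <= s <= h -> 0 <= t <= h -> D (s *: u + t *: v + x)) ->
  (forall y, D y -> differentiable f y /\ differentiable ('D_u f) y) ->
  exists s t, [/\ 0 <= s <= h, 0 <= t <= h &
    f (h *: u + h *: v + x) - f (h *: u + x) - f (h *: v + x) + f x =
    h ^+ 2 * 'D_v ('D_u f) (s *: u + t *: v + x)].
Proof.
move=> h0 hD df.
have h0h : 0 <= h <= h by rewrite lexx ltW.
have z0h : 0 <= (0 : R) <= h by rewrite lexx ltW.
have line (g : V -> R) w (y : V) (s : R) : differentiable g (s *: w + y) ->
    is_derive s 1 (fun s => g (s *: w + y)) ('D_w g (s *: w + y)).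
  move=> dg; have [] : is_derive (s *: w + y) w g ('D_w g (s *: w + y)).
    by apply/derivableP/diff_derivable.
  move=> H _; have E : (fun h0 : R => h0^-1 *:
       (((fun s => g (s *: w + y)) \o shift s) (h0 *: 1) - g (s *: w + y))) =
     (fun h0 : R => h0^-1 *: ((g \o shift (s *: w + y)) (h0 *: w) - g (s *: w + y))).
    apply/funext => r /=; congr (_ *: (g _ - _)).
    by rewrite scaler1 scalerDl addrA.
  by split; rewrite /derivable /derive E.
have [s sh Es] : exists2 s, s \in `]0, h[ &
   (f (h *: u + (h *: v + x)) - f (h *: u + x)) - (f (0 *: u + (h *: v + x)) - f (0 *: u + x)) =
   ('D_u f (s *: u + (h *: v + x)) - 'D_u f (s *: u + x)) * (h - 0).
  apply: (@MVT _ (fun s => f (s *: u + (h *: v + x)) - f (s *: u + x))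
    (fun s => 'D_u f (s *: u + (h *: v + x)) - 'D_u f (s *: u + x))) => //.
    move=> s; rewrite in_itv /= => /andP[s0 sh].
    apply: is_deriveB; apply: line.
      by rewrite addrA; case: (df _ (hD s h _ _)) => //; rewrite !ltW.
    by have [] // := df _ (hD s 0 _ z0h); rewrite ?scale0r ?addr0 // !ltW.
  apply: continuous_in_subspaceT => s; rewrite inE /= in_itv /= => sh.
  apply: differentiable_continuous; apply/derivable1_diffP.
  have [] // : is_derive s 1 (fun s => f (s *: u + (h *: v + x)) - f (s *: u + x))
    ('D_u f (s *: u + (h *: v + x)) - 'D_u f (s *: u + x)).
  apply: is_deriveB; apply: line.
    by rewrite addrA; case: (df _ (hD s h _ _)).
  by have [] // := df _ (hD s 0 _ z0h); rewrite ?scale0r ?addr0.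
have sh' : 0 <= s <= h by move: sh; rewrite in_itv /= => /andP[/ltW-> /ltW->].
have H1 t : 0 <= t <= h -> is_derive t 1 (fun t => 'D_u f (t *: v + (s *: u + x)))
    ('D_v ('D_u f) (t *: v + (s *: u + x))).
  move=> th; apply: line.
  by rewrite addrA [t *: v + _]addrC; case: (df _ (hD s t _ _)).
have H2 t : t \in `]0, h[ -> is_derive t 1 (fun t => 'D_u f (t *: v + (s *: u + x)))
    ('D_v ('D_u f) (t *: v + (s *: u + x))).
  by rewrite in_itv /= => /andP[t0 th]; apply: H1; rewrite !ltW.
have H3 : {within `[0, h], continuous (fun t => 'D_u f (t *: v + (s *: u + x)))}.
  apply: continuous_in_subspaceT => t; rewrite inE /= in_itv /= => /H1[+ _].
  by move=> dt; apply: differentiable_continuous; exact/derivable1_diffP.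
have [t th Et] := MVT h0 H2 H3.
exists s, t; split => //; first by move: th; rewrite in_itv /= => /andP[/ltW-> /ltW->].
move: Es Et; rewrite !scale0r !add0r subr0 => Es Et.
have -> : s *: u + t *: v + x = t *: v + (s *: u + x).
  by rewrite addrA [s *: u + _]addrC.
rewrite expr2 mulrC mulrA -Et [h *: v + (s *: u + x)]addrCA -Es -[h *: u + h *: v + x]addrA.
by rewrite opprB [RHS]addrA [LHS]addrAC.
Qed.

End Ck.

(** * Symmetry of second derivatives *)

Section Schwarz.
Variables (R : realType) (V : normedModType R).
Implicit Types (f g : V -> R) (D : set V).

Lemma ler_dist_of_half (a b c d e : R) : `|a - c| < e / 2 -> `|b - d| < e / 2 -> c = d ->
  `|a - b| <= e.
Proof.
move=> h1 h2 cd; apply: le_trans (ler_distD c _ _) _.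
by rewrite (splitr e); apply: lerD; [exact: ltW|rewrite cd distrC ltW].
Qed.

(** The second difference is symmetric in [u] and [v]. Divided by h^2, it equals each mixed
    derivative at some point close to [x], so by continuity the two values at [x] differ by at most
    any [e]. *)
Lemma schwarz D f u v x : open D -> smooth_on D f -> D x ->
  'D_v (fun y => 'D_u f y) x = 'D_u (fun y => 'D_v f y) x.
Proof.
move=> oD sf Dx.
have su := smooth_on_derive u sf; have sv := smooth_on_derive v sf.
have cuv := smooth_on_continuous (smooth_on_derive v su) Dx.
have cvu := smooth_on_continuous (smooth_on_derive u sv) Dx.
apply/eqP; rewrite -subr_eq0 -normr_le0; apply/ler_addgt0Pl => e e0; rewrite addr0.
have e20 : 0 < e / 2 by rewrite divr_gt0.
have /nbhs_ballP[r /= r0 hr] : \forall y \near x, [/\ D y,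
    `|'D_v ('D_u f) x - 'D_v ('D_u f) y| < e / 2 &
    `|'D_u ('D_v f) x - 'D_u ('D_v f) y| < e / 2].
  have n1 : \forall y \near x, D y by apply: open_nbhs_nbhs.
  have n2 : \forall y \near x, `|'D_v ('D_u f) x - 'D_v ('D_u f) y| < e / 2 :=
    (cvgrPdist_lt _ _).1 cuv _ e20.
  have n3 : \forall y \near x, `|'D_u ('D_v f) x - 'D_u ('D_v f) y| < e / 2 :=
    (cvgrPdist_lt _ _).1 cvu _ e20.
  by apply: filterS3 n1 (n2 _) (n3 _) => y.
pose N := `|u| + `|v| + 1.
have N0 : 0 < N by rewrite ltr_wpDl // addr_ge0.
(* [N] exceeds the sum of the norms of [u] and [v], so displacements with coefficients in [0, h]
   have norm at most r/2 and stay in the ball of radius [r]. *)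
pose h := r / 2 / N.
have h0 : 0 < h by rewrite !divr_gt0.
have hb s t : 0 <= s <= h -> 0 <= t <= h -> ball x r (s *: u + t *: v + x).
  move=> /andP[s0 sh] /andP[t0 th]; rewrite -ball_normE /ball_ /= opprD addrCA subrr addr0 normrN.
  apply: le_lt_trans (ler_normD _ _) _; rewrite !normrZ !ger0_norm //.
  apply: (@le_lt_trans _ _ (h * N)).
    rewrite /N !mulrDr mulr1; apply: ler_wpDr; first exact: ltW.
    by apply: lerD; rewrite ler_wpM2r.
  by rewrite /h divfK ?gt_eqF // ltr_pdivrMr // ltr_pMr // ltr1n.
have [s [t [sh th E1]]] := second_difference (D := D) (f := f) (x := x) (u := u) (v := v) h0
  (fun s t hs ht => let: And3 a _ _ := hr _ (hb s t hs ht) in a)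
  (fun y Dy => conj (smooth_on_differentiable sf Dy) (smooth_on_differentiable su Dy)).
have [t' [s' [th' sh' E2]]] := second_difference (D := D) (f := f) (x := x) (u := v) (v := u) h0
  (fun s t hs ht => let: And3 a _ _ := hr _ (eq_ind _ (ball x r) (hb t s ht hs) _
     (congr1 (+%R^~ x) (addrC (t *: u) (s *: v)))) in a)
  (fun y Dy => conj (smooth_on_differentiable sf Dy) (smooth_on_differentiable sv Dy)).
have E : 'D_v ('D_u f) (s *: u + t *: v + x) = 'D_u ('D_v f) (t' *: v + s' *: u + x).
  apply: (mulfI (x := h ^+ 2)); first by rewrite expf_neq0 // gt_eqF.
  apply: etrans (esym E1) _; apply: etrans _ E2; rewrite [h *: v + h *: u]addrC.
  by congr (_ + _); rewrite addrAC.
have [_ h1 _] := hr _ (hb _ _ sh th).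
have [_ _] := hr _ (hb _ _ sh' th'); rewrite [s' *: u + _]addrC => h2.
exact: ler_dist_of_half h1 h2 E.
Qed.

Lemma is_derive_differentiable f x v : differentiable f x ->
  is_derive x v f ('D_v f x).
Proof. by move=> df; apply/derivableP/diff_derivable. Qed.

End Schwarz.

(** * Functions of time and position *)

Section Slice.
Variables (R : realType) (V : normedModType R).
Local Notation RV := (R^o * V)%type.

Lemma differentiable_slice (f : RV -> R) (t : R^o) (x : V) :
  differentiable f (t, x) -> differentiable (fun y => f (t, y)) x.
Proof.
move=> df; apply: (@differentiable_comp _ _ _ _ (fun y : V => (t, y) : RV) f) => //.
Qed.

Lemma derive_slice (f : RV -> R) (t : R^o) (x v : V) :
  'D_v (fun y => f (t, y)) x = 'D_((0, v) : RV) f (t, x).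
Proof.
have E : (fun h : R => h^-1 *: (((fun y => f (t, y)) \o shift x) (h *: v) - f (t, x))) =
  (fun h : R => h^-1 *: ((f \o shift ((t, x) : RV)) (h *: ((0, v) : RV)) - f (t, x))).
  apply/funext => h; congr (_ *: (f _ - _)).
  by rewrite /= -[h *: ((0, v) : RV)]/((h *: (0 : R^o), h *: v) : RV) scaler0
  -[(0, h *: v) + (t, x)]/((0 + t, h *: v + x) : RV) add0r.
by rewrite /derive E.
Qed.

Lemma is_derive_slice (f : RV -> R) (t : R^o) (x : V) : differentiable f (t, x) ->
  is_derive t 1 (fun s => f (s, x)) ('D_((1, 0) : RV) f (t, x)).
Proof.
move=> /(is_derive_differentiable ((1, 0) : RV))[+ _].
have E : (fun h : R => h^-1 *: (((fun s => f (s, x)) \o shift t) (h *: (1 : R^o)) - f (t, x))) =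
  (fun h : R => h^-1 *: ((f \o shift ((t, x) : RV)) (h *: ((1, 0) : RV)) - f (t, x))).
  apply/funext => h; congr (_ *: (f _ - _)).
  by rewrite /= -[h *: ((1, 0) : RV)]/((h *: (1 : R^o), h *: 0) : RV) scaler0
    -[(h *: (1 : R^o), 0) + (t, x)]/((h *: (1 : R^o) + t, 0 + x) : RV) add0r.
by move=> df; split; rewrite /derivable /derive E.
Qed.

(** The derivative of a slice along [v] is the slice of the derivative along (0, v), so the
    induction on [k] ranges over all functions smooth on [D]. *)
Lemma smooth_on_slice (D : set RV) (D' : set V) (f : RV -> R) (t : R^o) :
  open D' -> (forall x, D' x -> D (t, x)) -> smooth_on D f ->
  smooth_on D' (fun x => f (t, x)).
Proof.
move=> oD' DD sf k; elim: k f sf => [|k IH] f sf /=.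
  move=> x Dx; apply: differentiable_continuous; apply: differentiable_slice.
  exact: smooth_on_differentiable sf (DD _ Dx).
split => [x Dx|v].
  by apply: differentiable_slice; exact: smooth_on_differentiable sf (DD _ Dx).
under [X in Ck_on _ _ X]funext => x do rewrite derive_slice.
exact: (IH (fun y => 'D_((0, v) : RV) f y)) (smooth_on_derive _ sf).
Qed.

End Slice.

(** * Differentiation of complex-valued functions *)

Section ComplexDerivative.
Variables (R : realType) (V : normedModType R).
Implicit Types (f g : V -> R[i]) (x v : V).

Definition differentiableC f x : Prop :=
  differentiable (fun y => reC (f y)) x /\ differentiable (fun y => imC (f y)) x.

(** The direction is real and [V] arbitrary, so that one notion serves time, the chart images and
    their product; [deriveC] is its extension to complex directions. *)
Definition derC f v x : R[i] :=
  Complex ('D_v (fun y => reC (f y)) x) ('D_v (fun y => imC (f y)) x).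

Lemma complexP (a b : R[i]) : reC a = reC b -> imC a = imC b -> a = b.
Proof. by case: a => ? ?; case: b => ? ? /= -> ->. Qed.

Lemma reM (a b : R[i]) : reC (a * b) = reC a * reC b - imC a * imC b.
Proof. by case: a; case: b. Qed.

Lemma imM (a b : R[i]) : imC (a * b) = reC a * imC b + imC a * reC b.
Proof. by case: a; case: b. Qed.

Lemma reD (a b : R[i]) : reC (a + b) = reC a + reC b.
Proof. by case: a; case: b. Qed.

Lemma imD (a b : R[i]) : imC (a + b) = imC a + imC b.
Proof. by case: a; case: b. Qed.

Lemma near_eq_differentiableC f g x : (\forall y \near x, f y = g y) ->
  differentiableC f x -> differentiableC g x.
Proof.
by move=> fg [df1 df2]; split; [apply: near_eq_differentiable df1|
  apply: near_eq_differentiable df2]; apply: filterS fg => y ->.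
Qed.

Lemma near_eq_derC f g v x : (\forall y \near x, f y = g y) ->
  derC f v x = derC g v x.
Proof.
by move=> fg; congr Complex; apply: near_eq_derive; apply: filterS fg => y ->.
Qed.

Lemma differentiableC_cst (c : R[i]) x : differentiableC (fun=> c) x.
Proof. by split; exact: differentiable_cst. Qed.

Lemma derC_cst (c : R[i]) v x : derC (fun=> c) v x = 0.
Proof. by apply: complexP; rewrite /= derive_cst. Qed.

Lemma differentiableC_add f g x : differentiableC f x -> differentiableC g x ->
  differentiableC (fun y => f y + g y) x.
Proof.
move=> [df1 df2] [dg1 dg2]; split.
  by under eq_fun do rewrite reD; exact: differentiableD.
by under eq_fun do rewrite imD; exact: differentiableD.
Qed.

Lemma derC_add f g v x : differentiableC f x -> differentiableC g x ->
  derC (fun y => f y + g y) v x = derC f v x + derC g v x.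
Proof.
move=> [df1 df2] [dg1 dg2]; apply: complexP; rewrite ?reD ?imD /=.
  by under eq_fun do rewrite reD; rewrite deriveD //; exact: diff_derivable.
by under eq_fun do rewrite imD; rewrite deriveD //; exact: diff_derivable.
Qed.

Lemma differentiableC_mul f g x : differentiableC f x -> differentiableC g x ->
  differentiableC (fun y => f y * g y) x.
Proof.
move=> [df1 df2] [dg1 dg2]; split.
  by under eq_fun do rewrite reM; apply: differentiableB; exact: differentiableM.
by under eq_fun do rewrite imM; apply: differentiableD; exact: differentiableM.
Qed.

Lemma derive_mul2 (a b c d : V -> R) v x : differentiable a x ->
  differentiable b x -> differentiable c x -> differentiable d x ->
  'D_v (fun y => a y * c y + b y * d y) x =
  'D_v a x * c x + a x * 'D_v c x + ('D_v b x * d x + b x * 'D_v d x).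
Proof.
move=> da db dc dd.
have da' : derivable a x v := diff_derivable da.
have db' : derivable b x v := diff_derivable db.
have dc' : derivable c x v := diff_derivable dc.
have dd' : derivable d x v := diff_derivable dd.
apply: etrans (deriveD (derivableM da' dc') (derivableM db' dd')) _.
congr (_ + _).
  apply: etrans (deriveM da' dc') _; apply: etrans (addrC _ _) _.
  by congr (_ + _); exact: mulrC.
apply: etrans (deriveM db' dd') _; apply: etrans (addrC _ _) _.
by congr (_ + _); exact: mulrC.
Qed.

Lemma derC_mul f g v x : differentiableC f x -> differentiableC g x ->
  derC (fun y => f y * g y) v x = derC f v x * g x + f x * derC g v x.
Proof.
move=> [df1 df2] [dg1 dg2].
have ndf2 : differentiable (fun y => - imC (f y)) x := differentiableN df2.
have dN : 'D_v (fun y => - imC (f y)) x = - 'D_v (fun y => imC (f y)) x.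
  exact: deriveN (diff_derivable df2).
apply: complexP; rewrite ?reD ?imD ?reM ?imM [LHS]/=.
  under eq_fun do rewrite reM -mulNr.
  by rewrite (derive_mul2 v df1 ndf2 dg1 dg2) dN addrACA !mulNr.
under eq_fun do rewrite imM.
by rewrite (derive_mul2 v df1 df2 dg2 dg1) addrACA.
Qed.

Lemma differentiableC_sum (I : Type) (r : seq I) (P : pred I) (F : I -> V -> R[i]) x :
  (forall i, differentiableC (F i) x) ->
  differentiableC (fun y => \sum_(i <- r | P i) F i y) x.
Proof.
move=> dF; elim: r => [|i r IH].
  by under eq_fun do rewrite big_nil; exact: differentiableC_cst.
under eq_fun do rewrite big_cons.
by case: (P i) => //; exact: differentiableC_add.
Qed.

Lemma derC_sum (I : Type) (r : seq I) (P : pred I) (F : I -> V -> R[i]) v x :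
  (forall i, differentiableC (F i) x) ->
  derC (fun y => \sum_(i <- r | P i) F i y) v x = \sum_(i <- r | P i) derC (F i) v x.
Proof.
move=> dF; elim: r => [|i r IH].
  by rewrite big_nil; under eq_fun do rewrite big_nil; exact: derC_cst.
rewrite big_cons; under eq_fun do rewrite big_cons.
case: (P i) => //; rewrite derC_add ?IH //; exact: differentiableC_sum.
Qed.

Lemma differentiableC_scale (c : R[i]) f x : differentiableC f x ->
  differentiableC (fun y => c * f y) x.
Proof. by apply: differentiableC_mul; exact: differentiableC_cst. Qed.

Lemma derC_scale (c : R[i]) f v x : differentiableC f x ->
  derC (fun y => c * f y) v x = c * derC f v x.
Proof.
move=> df; rewrite (derC_mul v (differentiableC_cst c x) df).
by rewrite derC_cst mul0r add0r.
Qed.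

(* The product rule for a multilinear expression: each row of B is expanded along
   the coordinate basis. *)
Lemma derC_multilinear m k (a : V -> covec R m k) (B : V -> 'M[R[i]]_(k, m)) x :
  (\forall y \near x, multilinear (a y)) ->
  (forall E, differentiableC (fun y => a y E) x) ->
  (forall i j, differentiableC (fun y => B y i j) x) ->
  differentiableC (fun y => a y (B y)) x /\
  forall v, derC (fun y => a y (B y)) v x = derC (fun y => a y (B x)) v x +
    \sum_i a x (setrow (B x) i (\row_j derC (fun y => B y i j) v x)).
Proof.
move=> aml da dB.
(* The rows listed in [r] vary with [y] and the others are frozen at those of [C]; the induction
   releases one row at a time. *)
pose M (r : seq 'I_k) (C : 'M[R[i]]_(k, m)) y : 'M[R[i]]_(k, m) :=
  \matrix_(i, j) if i \in r then B y i j else C i j.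
have axml := nbhs_singleton aml.
have key (r : seq 'I_k) : uniq r -> forall C,
    differentiableC (fun y => a y (M r C y)) x /\
    forall v, derC (fun y => a y (M r C y)) v x = derC (fun y => a y (M r C x)) v x +
      \sum_(i <- r) a x (setrow (M r C x) i (\row_j derC (fun y => B y i j) v x)).
  elim: r => [_ C|i r IH /= /andP[ir ur] C].
    have E y : M [::] C y = C by apply/matrixP => i j; rewrite mxE in_nil.
    split; first by under eq_fun do rewrite E.
    by move=> v; rewrite big_nil addr0; congr derC; apply/funext => y; rewrite !E.
  have E y : M (i :: r) C y = setrow (M r C y) i (\sum_j B y i j *: delta_mx 0 j).
    apply/matrixP => l j; rewrite !mxE in_cons; case: eqP => [->|] //=.
    rewrite summxE (bigD1 j) //= !mxE !eqxx mulr1 big1 ?addr0 // => j' jj.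
    by rewrite !mxE eqxx [j == j']eq_sym (negPf jj) mulr0.
  have E2 y (w : 'rV_m) : setrow (M r C y) i w = M r (setrow C i w) y.
    apply/matrixP => l j; rewrite !mxE; case: eqP => [->|] //.
    by rewrite (negPf ir).
  have En : \forall y \near x, \sum_j B y i j * a y (M r (setrow C i (delta_mx 0 j)) y) =
      a y (M (i :: r) C y).
    apply: filterS aml => y aml; rewrite E ml_setrow_sum //.
    by apply: eq_bigr => j _; rewrite E2.
  have d1 j := (IH ur (setrow C i (delta_mx 0 j))).1.
  have d2 j : differentiableC
      (fun y => B y i j * a y (M r (setrow C i (delta_mx 0 j)) y)) x.
    exact: differentiableC_mul.
  split; first by apply: near_eq_differentiableC En _; exact: differentiableC_sum.
  move=> v; rewrite -(near_eq_derC v En) derC_sum // big_cons.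
   under [LHS]eq_bigr => j _ do rewrite (derC_mul v (dB i j) (d1 j)) (IH ur _).2.
  rewrite big_split /= addrCA; congr (_ + _).
    rewrite E setrow_setrow.
    have -> : (\row_j derC (fun y => B y i j) v x) =
      \sum_j derC (fun y => B y i j) v x *: delta_mx 0 j.
      by rewrite [LHS]row_sum_delta; apply: eq_bigr => j _; rewrite mxE.
    rewrite ml_setrow_sum //; by apply: eq_bigr => j _; rewrite E2.
  under eq_bigr do rewrite mulrDr.
  rewrite big_split /=; congr (_ + _).
    have En' : \forall y \near x, \sum_j B x i j * a y (M r (setrow C i (delta_mx 0 j)) x) =
      a y (M (i :: r) C x).
      apply: filterS aml => y aml; rewrite E ml_setrow_sum //.
      by apply: eq_bigr => j _; rewrite E2.
    rewrite -(near_eq_derC v En') derC_sum; last by move=> j; exact: differentiableC_scale.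
    by apply: eq_bigr => j _; rewrite derC_scale.
  under eq_bigr do rewrite mulr_sumr.
  rewrite exchange_big /= big_seq [RHS]big_seq; apply: eq_bigr => l lr.
  have li : i != l by apply: contraNneq ir => ->.
  rewrite E setrowC // ml_setrow_sum //; apply: eq_bigr => j _.
  by rewrite -E2 setrowC.
have [d1 d2] := key (enum 'I_k) (enum_uniq _) 0.
have E y : M (enum 'I_k) 0 y = B y by apply/matrixP => i j; rewrite mxE mem_enum.
split; first by move: d1; under eq_fun do rewrite E.
move=> v; move: (d2 v); under eq_fun do rewrite E.
by rewrite E -big_enum /=.
Qed.

End ComplexDerivative.

Section SmoothC.
Variables (R : realType) (V : normedModType R).
Implicit Types (f g : V -> R[i]) (D : set V).

Lemma smoothC_on_congr D f g : open D -> (forall x, D x -> f x = g x) ->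
  smoothC_on D f -> smoothC_on D g.
Proof.
by move=> oD fg [s1 s2]; split; [apply: smooth_on_congr oD _ s1|
  apply: smooth_on_congr oD _ s2] => x Dx; rewrite fg.
Qed.

Lemma smoothC_on_cst D (c : R[i]) : smoothC_on D (fun=> c).
Proof. by split; exact: smooth_on_cst. Qed.

Lemma smoothC_on_add D f g : open D -> smoothC_on D f -> smoothC_on D g ->
  smoothC_on D (fun x => f x + g x).
Proof.
move=> oD [f1 f2] [g1 g2]; split.
  by under eq_fun do rewrite reD; exact: smooth_on_add.
by under eq_fun do rewrite imD; exact: smooth_on_add.
Qed.

Lemma smoothC_on_mul D f g : open D -> smoothC_on D f -> smoothC_on D g ->
  smoothC_on D (fun x => f x * g x).
Proof.
move=> oD [f1 f2] [g1 g2]; split.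
  under eq_fun do rewrite reM.
  apply: smooth_on_add => //; first exact: smooth_on_mul.
  by apply: smooth_on_opp => //; exact: smooth_on_mul.
under eq_fun do rewrite imM.
by apply: smooth_on_add => //; exact: smooth_on_mul.
Qed.

Lemma smoothC_on_scale D (c : R[i]) f : open D -> smoothC_on D f ->
  smoothC_on D (fun x => c * f x).
Proof. by move=> oD; apply: smoothC_on_mul oD (smoothC_on_cst _ _). Qed.

Lemma smoothC_on_sum D (I : Type) (r : seq I) (P : pred I) (F : I -> V -> R[i]) :
  open D -> (forall i, P i -> smoothC_on D (F i)) ->
  smoothC_on D (fun x => \sum_(i <- r | P i) F i x).
Proof.
move=> oD sF; elim: r => [|i r IH].
  by under eq_fun do rewrite big_nil; exact: smoothC_on_cst.
under eq_fun do rewrite big_cons.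
by case Pi : (P i) => //; apply: smoothC_on_add => //; exact: sF.
Qed.

Lemma smoothC_on_derC D f v : smoothC_on D f -> smoothC_on D (fun x => derC f v x).
Proof. by move=> [s1 s2]; split; exact: smooth_on_derive. Qed.

Lemma smoothC_on_differentiableC D f x : smoothC_on D f -> D x -> differentiableC f x.
Proof. by move=> [s1 s2] Dx; split; [move: s1|move: s2] => /smooth_on_differentiable; apply. Qed.

Lemma schwarzC D f u v x : open D -> smoothC_on D f -> D x ->
  derC (fun y => derC f u y) v x = derC (fun y => derC f v y) u x.
Proof.
by move=> oD [s1 s2] Dx; rewrite /derC /= (schwarz u v oD s1 Dx) (schwarz u v oD s2 Dx).
Qed.

End SmoothC.

Section SliceC.
Variables (R : realType) (V : normedModType R).
Local Notation RV := (R^o * V)%type.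

Lemma smoothC_on_slice (D : set RV) (D' : set V) (f : RV -> R[i]) (t : R^o) :
  open D' -> (forall x, D' x -> D (t, x)) -> smoothC_on D f ->
  smoothC_on D' (fun x => f (t, x)).
Proof.
move=> oD' DD [s1 s2]; split; first exact: (smooth_on_slice oD' DD s1).
exact: (smooth_on_slice oD' DD s2).
Qed.

Lemma derC_slice (f : RV -> R[i]) (t : R^o) (x v : V) :
  derC (fun y => f (t, y)) v x = derC f ((0, v) : RV) (t, x).
Proof. by rewrite /derC -!(derive_slice (fun z => _ (f z))). Qed.

Lemma differentiableC_slice1 (f : RV -> R[i]) (t : R^o) (x : V) :
  differentiableC f (t, x) -> differentiableC (fun s : R^o => f (s, x)) t.
Proof.
by move=> [d1 d2]; split; apply/derivable1_diffP;
  [have [] := is_derive_slice d1|have [] := is_derive_slice d2].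
Qed.

Lemma derC_slice1 (f : RV -> R[i]) (t : R^o) (x : V) :
  differentiableC f (t, x) ->
  derC (fun s : R^o => f (s, x)) 1 t = derC f ((1, 0) : RV) (t, x).
Proof.
move=> [/is_derive_slice[_ E1] /is_derive_slice[_ E2]].
by rewrite /derC E1 E2.
Qed.

End SliceC.

Section DeriveC.
Variables (R : realType) (m : nat).
Implicit Types (f : 'rV[R]_m -> R[i]) (w : 'rV[R[i]]_m).

Lemma deriveCE f w x : deriveC f w x =
  derC f (map_mx reC w) x + iC * derC f (map_mx imC w) x.
Proof. by []. Qed.

Lemma reC_sum (I : Type) (r : seq I) (P : pred I) (F : I -> R[i]) :
  reC (\sum_(i <- r | P i) F i) = \sum_(i <- r | P i) reC (F i).
Proof. by apply: (big_morph (@complex.Re R)); [exact: reD|]. Qed.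

Lemma imC_sum (I : Type) (r : seq I) (P : pred I) (F : I -> R[i]) :
  imC (\sum_(i <- r | P i) F i) = \sum_(i <- r | P i) imC (F i).
Proof. by apply: (big_morph (@complex.Im R)); [exact: imD|]. Qed.

Lemma derive_delta (f : 'rV[R]_m -> R) (u x : 'rV[R]_m) : differentiable f x ->
  'D_u f x = \sum_j u 0 j * 'D_(delta_mx 0 j) f x.
Proof.
move=> df; rewrite deriveE // {1}[u]row_sum_delta linear_sum /=.
by apply: eq_bigr => j _; rewrite linearZ /= deriveE.
Qed.

Lemma derC_delta f (u x : 'rV[R]_m) : differentiableC f x ->
  derC f u x = \sum_j Complex (u 0 j) 0 * derC f (delta_mx 0 j) x.
Proof.
move=> [d1 d2]; apply: complexP; rewrite ?reC_sum ?imC_sum /=.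
  rewrite derive_delta //; apply: eq_bigr => j _; by rewrite mul0r subr0.
by rewrite derive_delta //; apply: eq_bigr => j _; rewrite mul0r addr0.
Qed.

Lemma deriveC_delta f w x : differentiableC f x ->
  deriveC f w x = \sum_j w 0 j * derC f (delta_mx 0 j) x.
Proof.
move=> df; rewrite deriveCE !derC_delta // mulr_sumr -big_split /=.
apply: eq_bigr => j _; rewrite !mxE mulrA -mulrDl; congr (_ * _).
by apply: complexP; rewrite ?reD ?imD ?reM ?imM /=
  !(mul0r, mul1r, mulr0, subr0, addr0, add0r, sub0r, oppr0).
Qed.

Lemma deriveC_comb f x (b b' : R[i]) w w' : differentiableC f x ->
  deriveC f (b *: w + b' *: w') x = b * deriveC f w x + b' * deriveC f w' x.
Proof.
move=> df; rewrite !deriveC_delta // !mulr_sumr -big_split /=.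
by apply: eq_bigr => j _; rewrite !mxE mulrDl !mulrA.
Qed.

Lemma near_eq_deriveC f g w x : (\forall y \near x, f y = g y) ->
  deriveC f w x = deriveC g w x.
Proof. by move=> fg; rewrite !deriveCE !(near_eq_derC _ fg). Qed.

Lemma deriveC_add f g w x : differentiableC f x -> differentiableC g x ->
  deriveC (fun y => f y + g y) w x = deriveC f w x + deriveC g w x.
Proof. by move=> df dg; rewrite !deriveCE !derC_add // mulrDr addrACA. Qed.

Lemma deriveC_scale c f w x : differentiableC f x ->
  deriveC (fun y => c * f y) w x = c * deriveC f w x.
Proof. by move=> df; rewrite !deriveCE !derC_scale // mulrDr mulrCA. Qed.

Lemma deriveC_cst (c : R[i]) w x : deriveC (fun=> c) w x = 0.
Proof. by rewrite deriveCE !derC_cst mulr0 addr0. Qed.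

Lemma smoothC_on_deriveC D f w : open D -> smoothC_on D f ->
  smoothC_on D (fun x => deriveC f w x).
Proof.
move=> oD sf; apply: (smoothC_on_add oD (smoothC_on_derC _ sf)).
exact: (smoothC_on_scale _ oD (smoothC_on_derC _ sf)).
Qed.

End DeriveC.

Section RealComplexMatrix.
Variables (R : realType).

Lemma cmxE p q (A : 'M[R]_(p, q)) : cmx A = map_mx (real_complex R) A.
Proof. by []. Qed.

Lemma cmxM p q r (A : 'M[R]_(p, q)) (B : 'M[R]_(q, r)) : cmx (A *m B) = cmx A *m cmx B.
Proof. by rewrite !cmxE map_mxM. Qed.

Lemma cmx1 p : cmx (1%:M : 'M[R]_p) = 1%:M.
Proof. by rewrite cmxE map_mx1. Qed.

Lemma mulmx_row_inj p q (A B : 'M[R]_(p, q)) :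
  (forall v : 'rV_p, v *m A = v *m B) -> A = B.
Proof. by move=> h; apply/row_matrixP => i; rewrite !rowE h. Qed.

Lemma differentiable_rV (V : normedModType R) m (F : V -> 'rV[R]_m) x :
  (forall j, differentiable (fun y => F y 0 j) x) -> differentiable F x.
Proof.
move=> dF; have -> : F = \sum_(j < m) (fun y => F y 0 j *: delta_mx 0 j).
  apply/funext => y; rewrite [LHS]row_sum_delta fct_sumE.
  by apply: eq_bigr.
by apply: differentiable_sum => j; exact: differentiableZl.
Qed.

End RealComplexMatrix.

(** * Changes of charts and their Jacobians *)

Section Charts.
Variables (R : realType) (m : nat) (T : topologicalType).
Implicit Types c : chart R m T.

Lemma chart_imP c x : chart_im c x ->
  chart_dom c (chart_inv c x) /\ chart_coord c (chart_inv c x) = x.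
Proof. by case=> p cp <-; rewrite chart_coordK. Qed.

Lemma chart_imI c p : chart_dom c p -> chart_im c (chart_coord c p).
Proof. by move=> cp; exists p. Qed.

Lemma open_chart_im c : open (chart_im c).
Proof. exact: chart_im_open. Qed.
Arguments open_chart_im : clear implicits.

Lemma chart_coord_setIE c (U : set T) :
  chart_coord c @` (chart_dom c `&` U) = chart_im c `&` [set x | U (chart_inv c x)].
Proof.
apply/seteqP; split => x.
  by case=> p [cp Up] <-; split; [exact: chart_imI|rewrite /= chart_coordK].
by case=> /chart_imP[cx xx] Ux; exists (chart_inv c x).
Qed.

Lemma open_chart_coord_setI c (U : set T) : open U ->
  open (chart_coord c @` (chart_dom c `&` U)).
Proof.
move=> oU; rewrite chart_coord_setIE openE => x [cx Ux].
apply: filterI; first by apply: open_nbhs_nbhs; split => //; exact: open_chart_im.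
by apply: (chart_inv_cont cx); apply: open_nbhs_nbhs.
Qed.

Lemma chart_overlapE c c' x : chart_overlap c c' x <->
  chart_im c x /\ chart_dom c' (chart_inv c x).
Proof. by rewrite /chart_overlap chart_coord_setIE. Qed.

Lemma open_chart_overlap c c' : open (chart_overlap c c').
Proof. by apply: open_chart_coord_setI; exact: chart_dom_open. Qed.
Arguments open_chart_overlap : clear implicits.

Lemma transitionK c c' x : chart_overlap c c' x ->
  chart_inv c' (transition c c' x) = chart_inv c x.
Proof. by case/chart_overlapE => _ h; rewrite /transition chart_coordK. Qed.

Lemma transition_overlap c c' x : chart_overlap c c' x ->
  chart_overlap c' c (transition c c' x).
Proof.
move=> h; have [h1 h2] := (chart_overlapE _ _ _).1 h; apply/chart_overlapE.
by rewrite transitionK //; split; [exact: chart_imI|case: (chart_imP h1)].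
Qed.

Lemma mul_jac c c' x v : differentiable (transition c c') x ->
  v *m jac c c' x = 'D_v (transition c c') x.
Proof. by move=> d; rewrite deriveEjacobian. Qed.

Lemma smooth_transition_differentiable c c' D x :
  smooth_map_on D (transition c c') -> D x -> differentiable (transition c c') x.
Proof.
by move=> s Dx; apply: differentiable_rV => j; exact: smooth_on_differentiable (s j) Dx.
Qed.

Lemma jac_id c x : chart_im c x -> jac c c x = 1%:M.
Proof.
move=> cx; have E : \forall y \near x, id y = transition c c y.
  apply: (near_open (open_chart_im c) cx) => y /chart_imP[_].
  by rewrite /transition => ->.
apply: mulmx_row_inj => v; rewrite mulmx1 mul_jac.
  by rewrite -(near_eq_derive _ E) derive_id.
by apply: near_eq_differentiable E _.
Qed.

Lemma jac_chain c c' c'' x : chart_overlap c c' x ->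
  differentiable (transition c c') x ->
  differentiable (transition c' c'') (transition c c' x) ->
  differentiable (transition c c'') x /\
  jac c c'' x = jac c c' x *m jac c' c'' (transition c c' x).
Proof.
move=> cx d1 d2.
have E : \forall y \near x, (transition c' c'' \o transition c c') y = transition c c'' y.
  apply: (near_open (open_chart_overlap c c') cx) => y cy.
  by rewrite /= /transition -/(transition c c' y) transitionK.
have d : differentiable (transition c' c'' \o transition c c') x.
  exact: differentiable_comp.
have d3 := near_eq_differentiable E d.
split => //; apply: mulmx_row_inj => v.
apply: etrans (mul_jac v d3) _; apply: etrans _ (esym (mulmxA _ _ _)).
apply: etrans _ (esym (congr1 (mulmx^~ _) (mul_jac v d1))).
apply: etrans _ (esym (mul_jac _ d2)).
apply: etrans (esym (near_eq_derive v E)) _.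
apply: etrans (deriveE v d) _; apply: etrans _ (esym (deriveE _ d2)).
apply: etrans (congr1 (fun F => F v) (diff_comp d1 d2)) _.
exact: (esym (congr1 ('d (transition c' c'') (transition c c' x)) (deriveE v d1))).
Qed.

End Charts.
Arguments open_chart_im {R m T} c _ _.
Arguments open_chart_overlap {R m T} c c' _ _.

(* Pairing (i, l) with (l, i): the contributions of the symmetric second derivatives
   h of a change of charts cancel in the exterior derivative. *)
Lemma symmetric_cancel (R : realType) m k (a : covec R m k) (aml : multilinear a)
    (aalt : Defs.alternating a) (A : 'M[R[i]]_(k.+1, m))
    (h : 'I_k.+1 -> 'I_k.+1 -> 'rV[R[i]]_m) : (forall i l, h i l = h l i) ->
  \sum_(i < k.+1) (-1) ^+ i * \sum_l a (setrow (row' i A) l (h i (lift i l))) = 0.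
Proof.
move=> hsym.
(* The sum is completed to all pairs (i, l) by a zero diagonal, so that the two indices can be
   exchanged. *)
pose F (i l : 'I_k.+1) := if l == i then 0 else (-1) ^+ i * a (row' i (setrow A l (h i l))).
have -> : \sum_(i < k.+1) (-1) ^+ i * \sum_l a (setrow (row' i A) l (h i (lift i l))) =
    \sum_i \sum_l F i l.
  apply: eq_bigr => i _; rewrite (bigD1_ord i) //= {1}/F eqxx add0r mulr_sumr.
  apply: eq_bigr => l _; rewrite /F eq_sym (negPf (neq_lift i l)).
  by rewrite row'_setrow_lift.
apply: eq_oppr0; rewrite {1}exchange_big -sumrN /=; apply: eq_bigr => i _.
rewrite -sumrN; apply: eq_bigr => l _; rewrite /F eq_sym.
case: eqP => [_|/eqP li]; first by rewrite oppr0.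
apply/eqP; rewrite -addr_eq0; apply/eqP.
have il : i != l by rewrite eq_sym.
(* [M] carries the same vector in rows [i] and [l]; deleting one of these rows gives the two
   matrices to compare. *)
pose M := setrow (setrow A l (h i l)) i (h i l).
have -> : row' i (setrow A l (h i l)) = row' i M by rewrite row'_setrow.
have -> : row' l (setrow A i (h l i)) = row' l M.
  by rewrite /M setrowC // row'_setrow hsym.
rewrite addrC; apply: (alt_row'_cancel aml aalt il).
by rewrite /M !row_setrow eqxx eq_sym (negPf il) eqxx.
Qed.

(** * Forms read in charts *)

Section Forms.
Variables (R : realType) (m : nat) (T : topologicalType) (S : smooth_atlas R m T).
Local Notation ch := (chart_at S).

Lemma atlas_differentiable p q x : chart_overlap (ch p) (ch q) x ->
  differentiable (transition (ch p) (ch q)) x.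
Proof. exact: smooth_transition_differentiable (chart_at_smooth S p q). Qed.

Lemma atlas_jac_chain p q r x : chart_overlap (ch p) (ch q) x ->
  chart_dom (ch r) (chart_inv (ch p) x) ->
  jac (ch p) (ch r) x =
  jac (ch p) (ch q) x *m jac (ch q) (ch r) (transition (ch p) (ch q) x).
Proof.
move=> xq xr; apply: (jac_chain xq (atlas_differentiable xq) _).2.
apply: atlas_differentiable; apply/chart_overlapE; rewrite transitionK //.
by split => //; have /chart_overlapE[] := transition_overlap xq.
Qed.

(** By the chain rule, the Jacobian towards the reference chart of the point factors through
    [ch q]. *)
Lemma local_form_change k (a : cform R m T k) p q y A :
  chart_overlap (ch p) (ch q) y ->
  local_form S (ch p) a y A =
  local_form S (ch q) a (transition (ch p) (ch q) y) (A *m cmx (jac (ch p) (ch q) y)).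
Proof.
move=> yq; rewrite /local_form (transitionK yq) -mulmxA -cmxM.
by rewrite -(atlas_jac_chain yq (chart_at_dom S _)).
Qed.

Lemma local_form_at k (a : cform R m T k) p A :
  local_form S (ch p) a (chart_coord (ch p) p) A = a p A.
Proof.
have hp := chart_at_dom S p.
rewrite /local_form (chart_coordK hp) jac_id ?cmx1 ?mulmx1 //; exact: chart_imI.
Qed.

Lemma pullback_multilinear m' k (a : covec R m k) (M : 'M[R[i]]_(m', m)) :
  multilinear a -> multilinear (fun A : 'M[R[i]]_(k, m') => a (A *m M)).
Proof.
move=> aml; apply: multilinearI => A i b b' v w.
by rewrite !setrow_mulmx mulmxDl -!scalemxAl multilinear_setrow.
Qed.

Lemma pullback_alternating m' k (a : covec R m k) (M : 'M[R[i]]_(m', m)) :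
  Defs.alternating a -> Defs.alternating (fun A : 'M[R[i]]_(k, m') => a (A *m M)).
Proof.
by move=> aalt A i j ij hA; apply: (aalt _ _ _ ij); rewrite !row_mul hA.
Qed.

Section Smooth.
Variables (k : nat) (a : cform R m T k).
Hypothesis a_smooth : smooth_form S a.

Lemma local_form_multilinear c x : multilinear (local_form S c a x).
Proof. by apply: pullback_multilinear; have [] := a_smooth.1 (chart_inv c x). Qed.

Lemma local_form_alternating c x : Defs.alternating (local_form S c a x).
Proof. by apply: pullback_alternating; have [] := a_smooth.1 (chart_inv c x). Qed.

Lemma local_form_differentiable q x A : chart_im (ch q) x ->
  differentiableC (fun y => local_form S (ch q) a y A) x.
Proof. by move=> qx; exact: smoothC_on_differentiableC (a_smooth.2 q A) qx. Qed.

Lemma derC_comp (V W : normedModType R) (f : W -> R[i]) (F : V -> W) x v :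
  differentiable F x -> differentiableC f (F x) ->
  differentiableC (f \o F) x /\ derC (f \o F) v x = derC f ('D_v F x) (F x).
Proof.
move=> dF [d1 d2].
have e1 := differentiable_comp dF d1; have e2 := differentiable_comp dF d2.
split; first by split.
have H (g : W -> R) : differentiable g (F x) -> 'D_v (g \o F) x = 'D_('D_v F x) g (F x).
  move=> dg; apply: etrans (deriveE v (differentiable_comp dF dg)) _.
  apply: etrans (congr1 (fun F => F v) (diff_comp dF dg)) _.
  apply: etrans _ (esym (deriveE _ dg)).
  exact: (esym (congr1 ('d g (F x)) (deriveE v dF))).
by rewrite /derC -(H _ d1) -(H _ d2).
Qed.

(** The second differential of the change of charts at [x], extended complex-bilinearly. *)
Definition hess (c c' : chart R m T) (x : 'rV[R]_m) (v w : 'rV[R[i]]_m) : 'rV[R[i]]_m :=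
  \row_j \sum_b \sum_b' v 0 b * w 0 b' *
    Complex ('D_(delta_mx 0 b') (fun y => 'D_(delta_mx 0 b)
      (fun z => transition c c' z 0 j : R) y) x) 0.

Lemma hess_sym p q x v w : chart_overlap (ch p) (ch q) x ->
  hess (ch p) (ch q) x v w = hess (ch p) (ch q) x w v.
Proof.
move=> xq; apply/rowP => j; rewrite !mxE exchange_big /=.
apply: eq_bigr => b _; apply: eq_bigr => b' _; rewrite [v _ _ * _]mulrC.
have E := schwarz (delta_mx 0 b') (delta_mx 0 b)
  (open_chart_overlap _ _) (chart_at_smooth S p q j) xq.
by rewrite E.
Qed.

Lemma jac_entry p q x b j : chart_overlap (ch p) (ch q) x ->
  jac (ch p) (ch q) x b j =
  'D_(delta_mx 0 b) (fun z => transition (ch p) (ch q) z 0 j : R) x.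
Proof.
move=> xq; have d := atlas_differentiable xq.
have -> : jac (ch p) (ch q) x b j = ((delta_mx 0 b : 'rV_m) *m jac (ch p) (ch q) x) 0 j.
  by rewrite -rowE [RHS]mxE.
by rewrite (mul_jac _ d) derive_mx ?mxE //; exact: diff_derivable.
Qed.

Lemma hess_re_im c c' x v w :
  hess c c' x v w =
  hess c c' x v (cmx (map_mx reC w)) + iC *: hess c c' x v (cmx (map_mx imC w)).
Proof.
apply/rowP => j; rewrite !mxE mulr_sumr -big_split /=; apply: eq_bigr => b _.
rewrite mulr_sumr -big_split /=; apply: eq_bigr => b' _; rewrite !mxE.
rewrite mulrA -mulrDl; congr (_ * _); rewrite mulrCA -mulrDr; congr (_ * _).
by case: (w 0 b') => p q /=; apply: complexP; rewrite ?reD ?imD ?reM ?imM /=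
  !(mul0r, mul1r, mulr0, subr0, addr0, add0r, sub0r, oppr0).
Qed.

Lemma re_mul_cmx (w : 'rV[R[i]]_m) (J : 'M[R]_m) :
  map_mx reC (w *m cmx J) = map_mx reC w *m J.
Proof.
apply/rowP => j; rewrite !mxE reC_sum; apply: eq_bigr => b _.
by rewrite !mxE reM /= mulr0 subr0.
Qed.

Lemma im_mul_cmx (w : 'rV[R[i]]_m) (J : 'M[R]_m) :
  map_mx imC (w *m cmx J) = map_mx imC w *m J.
Proof.
apply/rowP => j; rewrite !mxE imC_sum; apply: eq_bigr => b _.
by rewrite !mxE imM /= mulr0 add0r.
Qed.

(** The product rule applied to the pullback: differentiating the coefficients gives the derivative
    in the chart [ch q], by the chain rule, and differentiating the Jacobian applied to row [l]
    gives the second differential. *)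
Lemma derC_local_change p q x B (u : 'rV[R]_m) : chart_overlap (ch p) (ch q) x ->
  let J := jac (ch p) (ch q) x in
  let z := transition (ch p) (ch q) x in
  derC (fun y => local_form S (ch p) a y B) u x =
  derC (fun y => local_form S (ch q) a y (B *m cmx J)) (u *m J) z +
  \sum_l local_form S (ch q) a z
    (setrow (B *m cmx J) l (hess (ch p) (ch q) x (row l B) (cmx u))).
Proof.
move=> xq J z.
set D := chart_overlap (ch p) (ch q).
have oD : open D := open_chart_overlap _ _.
pose tau := transition (ch p) (ch q).
pose G j b y := 'D_(delta_mx 0 b) (fun y => tau y 0 j : R) y.
have sG j b : smooth_on D (G j b).
  exact: smooth_on_derive (chart_at_smooth S p q j).
(* The product of [B] with the Jacobian, written through the partial derivatives of the transition
   map, whose differentiability is known. *)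
pose B' y : 'M[R[i]]_(k, m) := \matrix_(l, j) \sum_b B l b * Complex (G j b y) 0.
have B'E y : D y -> B *m cmx (jac (ch p) (ch q) y) = B' y.
  move=> Dy; apply/matrixP => l j; rewrite !mxE; apply: eq_bigr => b _.
  by rewrite mxE (jac_entry _ _ Dy).
pose al y := local_form S (ch q) a (tau y).
have En : \forall y \near x, al y (B' y) = local_form S (ch p) a y B.
  apply: (near_open oD xq) => y Dy.
  by rewrite (local_form_change _ _ Dy) (B'E _ Dy).
have dz : chart_im (ch q) z by have /chart_overlapE[] := transition_overlap xq.
have dal E := derC_comp u (atlas_differentiable xq) (local_form_differentiable E dz).
have dG j b : differentiableC (fun y => Complex (G j b y) 0) x.
  by split; [exact: smooth_on_differentiable (sG j b) xq|exact: differentiable_cst].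
have dB' l j : differentiableC (fun y => B' y l j) x.
  under eq_fun do rewrite mxE.
  by apply: differentiableC_sum => b; apply: differentiableC_scale.
have alml : \forall y \near x, multilinear (al y).
  by apply: filterE => y; exact: local_form_multilinear.
have hB' l : \row_j derC (fun y => B' y l j) u x =
    hess (ch p) (ch q) x (row l B) (cmx u).
  apply/rowP => j; rewrite !mxE.
  have -> : (fun y => B' y l j) = (fun y => \sum_b B l b * Complex (G j b y) 0).
    by apply/funext => y; rewrite mxE.
  rewrite derC_sum; last by move=> b; exact: differentiableC_scale.
  apply: eq_bigr => b _; rewrite derC_scale // (derC_delta _ (dG j b)) mulr_sumr.
  apply: eq_bigr => b' _; rewrite !mxE mulrA; congr (_ * _).
  by rewrite /derC /= derive_cst.
have B'x := B'E x xq; rewrite -/J in B'x; clearbody B'.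
apply: etrans (esym (near_eq_derC u En)) _.
apply: etrans ((derC_multilinear alml (fun E => (dal E).1) dB').2 u) _.
rewrite -B'x.
apply: (congr2 +%R).
  apply: etrans (dal _).2 _.
  by rewrite -(mul_jac _ (atlas_differentiable xq)).
by apply: eq_bigr => l _; rewrite hB'.
Qed.

Lemma deriveC_local_change p q x B w : chart_overlap (ch p) (ch q) x ->
  let J := cmx (jac (ch p) (ch q) x) in
  let z := transition (ch p) (ch q) x in
  deriveC (fun y => local_form S (ch p) a y B) w x =
  deriveC (fun y => local_form S (ch q) a y (B *m J)) (w *m J) z +
  \sum_l local_form S (ch q) a z (setrow (B *m J) l (hess (ch p) (ch q) x (row l B) w)).
Proof.
move=> xq J z.
have E1 := derC_local_change B (map_mx reC w) xq.
have E2 := derC_local_change B (map_mx imC w) xq.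
apply: etrans (congr2 (fun a b => a + iC * b) E1 E2) _.
rewrite -/J -/z mulrDr addrACA; apply: (congr2 +%R).
  by rewrite deriveCE re_mul_cmx im_mul_cmx.
rewrite mulr_sumr -big_split /=; apply: eq_bigr => l _.
rewrite [in RHS]hess_re_im; have aml := local_form_multilinear (ch q) z.
by rewrite (ml_setrowD aml) (ml_setrowZ aml).
Qed.

End Smooth.
End Forms.

Lemma row'_mul (K : pzRingType) k m m' (A : 'M[K]_(k, m)) (M : 'M[K]_(m, m')) i :
  row' i (A *m M) = row' i A *m M.
Proof.
by apply/matrixP => l j; rewrite !mxE; apply: eq_bigr => c _; rewrite !mxE.
Qed.

(** * The exterior derivative in a fixed chart *)

Section ExtD.
Variables (R : realType) (m : nat) (T : topologicalType) (S : smooth_atlas R m T).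
Variables (k : nat) (a : cform R m T k).
Hypothesis a_smooth : smooth_form S a.
Local Notation ch := (chart_at S).

(** The exterior derivative computed in the single chart [ch q] at all points of its image, whereas
    [ext_d] changes chart with the point. *)
Definition chart_d q x (A : 'M[R[i]]_(k.+1, m)) : R[i] :=
  \sum_(i < k.+1) (-1) ^+ i *
    deriveC (fun y => local_form S (ch q) a y (row' i A)) (row i A) x.

Lemma ext_dE p A : ext_d S a p A = chart_d p (chart_coord (ch p) p) A.
Proof. by []. Qed.

(** Invariance of d under changes of charts: the terms with first derivatives correspond to each
    other, and those with second differentials add up to 0 by [symmetric_cancel]. *)
Lemma local_ext_d q x A : chart_im (ch q) x ->
  local_form S (ch q) (ext_d S a) x A = chart_d q x A.
Proof.
move=> qx; set p := chart_inv (ch q) x.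
have xp : chart_overlap (ch q) (ch p) x.
  by apply/chart_overlapE; split => //; exact: chart_at_dom.
rewrite /local_form -/p ext_dE /chart_d.
set J := cmx _.
have -> : chart_coord (ch p) p = transition (ch q) (ch p) x by [].
apply/esym.
have E i := deriveC_local_change a_smooth (row' i A) (row i A) xp.
pose z := transition (ch q) (ch p) x.
pose h i l := hess (ch q) (ch p) x (row l A) (row i A).
pose X i := deriveC (fun y => local_form S (ch p) a y (row' i A *m J)) (row i A *m J) z.
pose Y i := \sum_l local_form S (ch p) a z (setrow (row' i A *m J) l
  (hess (ch q) (ch p) x (row l (row' i A)) (row i A))).
apply: (@etrans _ _ (\sum_(i < k.+1) ((-1) ^+ i * X i + (-1) ^+ i * Y i))).
  by apply: eq_bigr => i _; rewrite -mulrDr; exact: (congr2 *%R (erefl _) (E i)).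
rewrite big_split /= -[RHS]addr0; apply: (congr2 +%R).
  by apply: eq_bigr => i _; rewrite /X row_mul -row'_mul.
have hsym i l : h i l = h l i by exact: (hess_sym _ _ xp).
have aml := local_form_multilinear a_smooth (ch p) z.
have aalt := local_form_alternating a_smooth (ch p) z.
apply: etrans _ (symmetric_cancel aml aalt (A *m J) hsym).
apply: eq_bigr => i _; apply: (congr2 *%R) => //.
apply: eq_bigr => l _; rewrite /h -row'_mul.
by have -> : row l (row' i A) = row (lift i l) A by apply/rowP => j; rewrite !mxE.
Qed.

Lemma chart_d_smooth q A : smoothC_on (chart_im (ch q)) (fun x => chart_d q x A).
Proof.
have oq := open_chart_im (ch q).
apply: smoothC_on_sum => // i _; apply: smoothC_on_scale => //.
by apply: smoothC_on_deriveC => //; exact: a_smooth.2.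
Qed.

(** In the term of index [l], row [i] is either the direction of differentiation or an argument of
    the form, and it enters linearly in both roles. *)
Lemma chart_d_multilinear q x : chart_im (ch q) x -> multilinear (chart_d q x).
Proof.
move=> qx; apply: multilinearI => A i b b' v w.
rewrite /chart_d !mulr_sumr -big_split /=; apply: eq_bigr => l _.
have dl := local_form_differentiable a_smooth _ qx.
rewrite mulrCA [b' * _]mulrCA -mulrDr; congr (_ * _).
case: (unliftP l i) => [j ->|->].
  rewrite !row_setrow (negPf (neq_lift l j)) !row'_setrow_lift.
  have E y : local_form S (ch q) a y (setrow (row' l A) j (b *: v + b' *: w)) =
    b * local_form S (ch q) a y (setrow (row' l A) j v) +
    b' * local_form S (ch q) a y (setrow (row' l A) j w).
    by apply: multilinear_setrow; exact: local_form_multilinear.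
  under eq_fun do rewrite E.
  rewrite deriveC_add; [|by apply: differentiableC_scale..].
  by rewrite !deriveC_scale.
by rewrite !row_setrow eqxx !row'_setrow deriveC_comb.
Qed.

(** Terms of index other than [i] and [l] differentiate a function that is 0, the form having two
    equal arguments; the two remaining terms have the same direction and cancel by
    [alt_row'_cancel]. *)
Lemma chart_d_alternating q x : chart_im (ch q) x -> Defs.alternating (chart_d q x).
Proof.
move=> qx A i l il hA.
have dl := local_form_differentiable a_smooth _ qx.
have aml y := local_form_multilinear a_smooth (ch q) y.
have aalt y := local_form_alternating a_smooth (ch q) y.
pose F (s : 'I_k.+1) := (-1) ^+ s * deriveC (fun y => local_form S (ch q) a y (row' s A)) (row s A) x.
have F0 s : s != i -> s != l -> F s = 0.
  move=> si sl; rewrite /F.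
  have -> : (fun y => local_form S (ch q) a y (row' s A)) = fun=> 0.
    apply/funext => y.
    have /unlift_some[i' hi' _] : s != i by [].
    have /unlift_some[l' hl' _] : s != l by [].
    apply: (aalt y _ i' l').
      by apply: contraNneq il => e; rewrite hi' hl' e.
    have -> : row i' (row' s A) = row i A by apply/rowP => j; rewrite !mxE hi'.
    by rewrite hA; apply/rowP => j; rewrite !mxE hl'.
  by rewrite deriveC_cst mulr0.
have F1 : F i + F l = 0.
  rewrite /F hA -(deriveC_scale _ _ (dl _)) -(deriveC_scale _ _ (dl _)).
  rewrite -deriveC_add; [|by apply: differentiableC_scale..].
  have -> : (fun y => (-1) ^+ i * local_form S (ch q) a y (row' i A) +
      (-1) ^+ l * local_form S (ch q) a y (row' l A)) = fun=> 0.
    by apply/funext => y; apply: (alt_row'_cancel (aml y) (aalt y) il hA).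
  exact: deriveC_cst.
have li : l != i by rewrite eq_sym.
have -> : chart_d q x A = \sum_s F s by [].
clearbody F; rewrite (bigD1 i) //= (bigD1 l li) /= addrA F1 add0r.
by apply: big1 => s /andP[si sl]; exact: F0.
Qed.

Lemma ext_d_smooth : smooth_form S (ext_d S a).
Proof.
split.
  move=> p; have hp := chart_imI (chart_at_dom S p).
  by split; [exact: (chart_d_multilinear hp)|exact: (chart_d_alternating hp)].
move=> q A /=; apply: smoothC_on_congr (chart_d_smooth q A).
  exact: open_chart_im.
by move=> x qx; rewrite local_ext_d.
Qed.

End ExtD.

(** * Holomorphic charts and types of forms *)

Section Holomorphic.
Variables (R : realType) (n : nat) (T : topologicalType).
Local Notation J := (cmx (@Jstd R n)).

Lemma deriveC_lin_sum m (f : 'rV[R]_m -> R[i]) x (I : Type) (r : seq I) (c : I -> R[i])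
    (v : I -> 'rV[R[i]]_m) : differentiableC f x ->
  deriveC f (\sum_(i <- r) c i *: v i) x = \sum_(i <- r) c i * deriveC f (v i) x.
Proof.
move=> df; elim: r => [|i r IH].
  by rewrite !big_nil deriveC_delta // big1 // => j _; rewrite mxE mul0r.
by rewrite !big_cons -[X in _ + X]scale1r deriveC_comb // mul1r IH.
Qed.

Lemma differentiable_entry m (V : normedModType R) (F : V -> 'rV[R]_m) x j :
  differentiable F x -> differentiable (fun y => F y 0 j : R) x.
Proof.
move=> dF; apply: (differentiable_comp (f := F) (g := fun N : 'rV[R]_m => N 0 j)) dF _.
exact: differentiable_coord.
Qed.

Section CoordinateFunction.
Variables (c c' : chart R (n + n) T) (x : 'rV[R]_(n + n)).
Hypothesis d : differentiable (transition c c') x.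

Definition zcoord (k : 'I_n) (y : 'rV[R]_(n + n)) : R[i] :=
  Complex (transition c c' y 0 (lshift n k)) (transition c c' y 0 (rshift n k)).

Lemma zcoord_differentiable k : differentiableC (zcoord k) x.
Proof. by split; exact: differentiable_entry. Qed.

Lemma derC_zcoord k u :
  derC (zcoord k) u x = Complex ((u *m jac c c' x) 0 (lshift n k)) ((u *m jac c c' x) 0 (rshift n k)).
Proof.
have dv : derivable (transition c c') x u := diff_derivable d.
by rewrite (mul_jac u d) (derive_mx dv) !mxE.
Qed.

Lemma deriveC_zcoord k w : deriveC (zcoord k) w x = dz k (w *m cmx (jac c c' x)).
Proof.
rewrite deriveCE !derC_zcoord -re_mul_cmx -im_mul_cmx.
move: (w *m _) => u; rewrite !mxE /dz; move: (u 0 (lshift n k)) (u 0 (rshift n k)) => [a b] [a' b'] /=.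
by apply: complexP => /=; ring.
Qed.

End CoordinateFunction.

Variable X : complex_structure R n T.
Local Notation ch := (chart_at X).

(** Cauchy-Riemann: each d/dzbar_j kills the complex coordinates of the target chart, so the image
    of [v] is killed by every dz_k. *)
Lemma jac_T01 p q x v : chart_overlap (ch p) (ch q) x -> T01 v ->
  T01 (v *m cmx (jac (ch p) (ch q) x)).
Proof.
move=> xq hv; apply: T01_dz => k.
have d := atlas_differentiable xq.
rewrite -(deriveC_zcoord d) -[v](proj01_id hv) proj01E.
rewrite deriveC_lin_sum; last exact: zcoord_differentiable.
apply: big1 => j _; have [_ h] := trans_holo X p q k.
by have := h _ xq j => /= h'; rewrite [X in _ * X]h' mulr0.
Qed.

Lemma cmx_re (A B C D : 'rV[R]_(n + n)) :
  cmx A + iC *: cmx B = - iC *: cmx C + cmx D -> A = D.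
Proof.
move=> /rowP h; apply/rowP => j; have := h j; rewrite !mxE => /(congr1 reC) /=.
by rewrite !(mul0r, mul1r, mulr0, subr0, addr0, add0r, sub0r, oppr0).
Qed.

(** For a real vector u, the vector u + i uJ has type (0,1), hence so has its image; the real part
    of the equation expressing this is the commutation evaluated at u. *)
Lemma jac_Jstd p q x : chart_overlap (ch p) (ch q) x ->
  Jstd *m jac (ch p) (ch q) x = jac (ch p) (ch q) x *m Jstd.
Proof.
move=> xq; set P := jac _ _ _; apply: mulmx_row_inj => u; rewrite !mulmxA.
have hv : T01 (cmx u + iC *: (cmx u *m J)).
  rewrite /T01 mulmxDl -scalemxAl J2 scalerN scalerDr scalerA mulNr iC2 opprK.
  by rewrite scale1r scaleNr addrC.
have := jac_T01 xq hv; rewrite -/P /T01 !mulmxDl -!scalemxAl -!cmxM scalerDr scalerA.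
by rewrite mulNr iC2 opprK scale1r => /cmx_re ->.
Qed.

Lemma mul_jac_J p q x (v : 'rV[R[i]]_(n + n)) : chart_overlap (ch p) (ch q) x ->
  v *m cmx (jac (ch p) (ch q) x) *m J = v *m J *m cmx (jac (ch p) (ch q) x).
Proof. by move=> xq; rewrite -!mulmxA -!cmxM jac_Jstd. Qed.

Lemma jac_proj10 p q x v : chart_overlap (ch p) (ch q) x ->
  proj10 (v *m cmx (jac (ch p) (ch q) x)) = proj10 v *m cmx (jac (ch p) (ch q) x).
Proof. by move=> xq; rewrite /proj10 mul_jac_J // -scalemxAl mulmxBl -scalemxAl. Qed.

Lemma jac_proj01 p q x v : chart_overlap (ch p) (ch q) x ->
  proj01 (v *m cmx (jac (ch p) (ch q) x)) = proj01 v *m cmx (jac (ch p) (ch q) x).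
Proof. by move=> xq; rewrite /proj01 mul_jac_J // -scalemxAl mulmxDl -scalemxAl. Qed.

Lemma chart_overlap_self q x : chart_im (ch q) x -> chart_overlap (ch q) (ch (chart_inv (ch q) x)) x.
Proof. by move=> qx; apply/chart_overlapE; split => //; exact: chart_at_dom. Qed.

Lemma proj_rows_mul k (A : 'M[R[i]]_(k, n + n)) S (P : 'M[R[i]]_(n + n)) :
  (forall v, proj10 (v *m P) = proj10 v *m P) ->
  (forall v, proj01 (v *m P) = proj01 v *m P) ->
  proj_rows S (A *m P) = proj_rows S A *m P.
Proof.
move=> h1 h2; apply/row_matrixP => i.
apply: etrans (row_proj_rows S (A *m P) i) _.
apply: etrans _ (esym (row_mul i (proj_rows S A) P)).
apply: etrans _ (esym (congr1 (mulmx^~ P) (row_proj_rows S A i))).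
by rewrite (row_mul i A P); case: (i \in S).
Qed.

(** The Jacobians of holomorphic changes of charts commute with the projections on both types, so
    taking a component may be done in any chart of X. *)
Lemma local_form_proj k p (a : cform R (n + n) T k) q x A : chart_im (ch q) x ->
  local_form X (ch q) (form_proj p a) x A = covec_proj p (local_form X (ch q) a x) A.
Proof.
move=> qx; have xq := chart_overlap_self qx.
have E S := proj_rows_mul A S (fun v => jac_proj10 v xq) (fun v => jac_proj01 v xq).
by apply: eq_bigr => S _; exact: (congr1 (a _) (E S)).
Qed.

Lemma form_proj_smooth k p (a : cform R (n + n) T k) :
  smooth_form X a -> smooth_form X (form_proj p a).
Proof.
move=> [a1 a2]; split.
  move=> y; have [aml aalt] := a1 y.
  by split; [exact: covec_proj_multilinear|exact: covec_proj_alternating].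
move=> q A /=; have oq := open_chart_im (ch q).
apply: smoothC_on_congr oq _ (smoothC_on_sum (index_enum _) oq
  (fun S _ => a2 q (proj_rows S A))) => x qx.
by rewrite (local_form_proj _ _ _ qx) covec_projE.
Qed.

(** With [S] the set of (1,0)-rows, this is the number of them left after row [i] is deleted. *)
Definition row_card k (S : {set 'I_k.+1}) (i : 'I_k.+1) : nat := #|S| - (i \in S).

Lemma typed_row' k (B : 'M[R[i]]_(k.+1, n + n)) (S : {set 'I_k.+1}) i : typed B S ->
  exists2 S', typed (row' i B) S' & #|S'| = row_card S i.
Proof.
move=> hB; exists [set l | lift i l \in S]%SET.
  move=> l; rewrite finset.in_set; have := hB (lift i l).
  by have -> // : row l (row' i B) = row (lift i l) B by apply/rowP => j; rewrite !mxE.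
rewrite /row_card; have -> : #|S| = ((i \in S) + #|[set l | lift i l \in S]%SET|)%N.
  rewrite -sum1_card big_mkcond (bigD1_ord i) //= -[#|[set l | _]%SET|]sum1_card.
  rewrite [in RHS]big_mkcond; apply: (congr2 addn); first by case: ifP.
  by apply: eq_bigr => l _; rewrite finset.in_set.
by rewrite addKn.
Qed.

(** Deleting a row of a typed matrix leaves a typed matrix, on which the component of index [p] is
    either all of [a] or 0. Each term of d thus belongs to exactly one component. *)
Lemma typed_ext_d k (a : cform R (n + n) T k) p y B (S : {set 'I_k.+1}) :
  smooth_form X a -> typed B S ->
  ext_d X (form_proj p a) y B = \sum_(i < k.+1) (-1) ^+ i *
    (if row_card S i == p then
       deriveC (fun z => local_form X (ch y) a z (row' i B)) (row i B)
         (chart_coord (ch y) y) else 0).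
Proof.
move=> sa hB; rewrite ext_dE /chart_d; apply: eq_bigr => i _.
apply: (congr2 *%R (erefl _)).
have [S' hS' <-] := typed_row' i hB.
have hy := chart_imI (chart_at_dom X y).
have E : \forall z \near chart_coord (ch y) y,
    local_form X (ch y) (form_proj p a) z (row' i B) =
    if #|S'| == p then local_form X (ch y) a z (row' i B) else 0.
  apply: (near_open (open_chart_im (ch y)) hy) => z hz.
  rewrite (local_form_proj _ _ _ hz) (covec_proj_typed _ _ hS') //.
  exact: local_form_multilinear.
apply: etrans (near_eq_deriveC _ E) _.
by case: (#|S'| == p) => //; exact: deriveC_cst.
Qed.

Lemma ext_d_form0 k y A : ext_d X (form0 : cform R (n + n) T k) y A = 0.
Proof.
by rewrite ext_dE /chart_d big1 // => i _; rewrite deriveC_cst mulr0.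
Qed.

Lemma covec_proj_cst0 k p : covec_proj p (fun=> 0) = (fun=> 0) :> covec R (n + n) k.
Proof. by apply/funext => A; apply: big1. Qed.

Lemma form_proj0 k p : form_proj p (form0 : cform R (n + n) T k) = form0.
Proof. by apply/funext => y; exact: covec_proj_cst0. Qed.

Lemma delbar_form0 k : delbar X (form0 : cform R (n + n) T k) = form0.
Proof.
apply/funext => y; apply/funext => A; rewrite /delbar big1 // => p _.
rewrite form_proj0 /form_proj (_ : ext_d X form0 y = fun=> 0) ?covec_proj_cst0 //.
by apply/funext => B; exact: ext_d_form0.
Qed.

Section Comb.
Variables (k : nat) (a b : cform R (n + n) T k) (c : R[i]).
Local Notation ab := (fun x A => a x A + c * b x A).

Lemma form_proj_comb p :
  form_proj p (ab : cform _ _ T k) = fun x A => form_proj p a x A + c * form_proj p b x A.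
Proof.
apply/funext => x; apply/funext => A.
by rewrite /form_proj !covec_projE mulr_sumr -big_split.
Qed.

Lemma smooth_form_comb : smooth_form X a -> smooth_form X b -> smooth_form X (ab : cform _ _ T k).
Proof.
move=> [a1 a2] [b1 b2]; split.
  move=> y; have [aml aalt] := a1 y; have [bml balt] := b1 y; split.
    apply: multilinearI => A i d d' v w.
    rewrite (multilinear_setrow aml) (multilinear_setrow bml) !mulrDr addrACA.
    by rewrite !mulrA ![c * _]mulrC.
  by move=> A i j ij hA; rewrite (aalt _ _ _ ij hA) (balt _ _ _ ij hA) mulr0 addr0.
move=> q A /=; have oq := open_chart_im (ch q).
by apply: (smoothC_on_add oq (a2 q A)); exact: (smoothC_on_scale c oq (b2 q A)).
Qed.

Lemma ext_d_comb y A : smooth_form X a -> smooth_form X b ->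
  ext_d X (ab : cform _ _ T k) y A = ext_d X a y A + c * ext_d X b y A.
Proof.
move=> sa sb; have hy := chart_imI (chart_at_dom X y).
rewrite !ext_dE /chart_d mulr_sumr -big_split; apply: eq_bigr => i _.
have da := local_form_differentiable sa (row' i A) hy.
have db := local_form_differentiable sb (row' i A) hy.
rewrite (mulrCA c); apply: etrans _ (mulrDr _ _ _); apply: (congr2 *%R (erefl _)).
apply: etrans (deriveC_add _ da (differentiableC_scale c db)) _.
by rewrite deriveC_scale.
Qed.

Lemma Apq_comb p q : Apq X p q a -> Apq X p q b -> Apq X p q (ab : cform _ _ T k).
Proof.
move=> [sa ta] [sb tb]; split; first exact: smooth_form_comb.
move=> x; have [pq ha] := ta x; have [_ hb] := tb x; split => // A S hA hS.
by rewrite (ha A S) // (hb A S) // mulr0 addr0.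
Qed.

End Comb.

Lemma delbar_comb k (a b : cform R (n + n) T k) (c : R[i]) :
  smooth_form X a -> smooth_form X b ->
  delbar X (fun x A => a x A + c * b x A) =
  fun x A => delbar X a x A + c * delbar X b x A.
Proof.
move=> sa sb; apply/funext => y; apply/funext => A.
apply: etrans _ (congr1 (+%R _) (esym (mulr_sumr _ _ _ _))).
rewrite /delbar -big_split; apply: eq_bigr => p _.
rewrite form_proj_comb; apply: etrans _ (congr1 (+%R _) (esym (mulr_sumr _ _ _ _))).
apply: etrans _ (big_split _ _ _ _ _) => /=; apply: eq_bigr => S _.
by apply: ext_d_comb; exact: form_proj_smooth.
Qed.

End Holomorphic.

(** * The operators del and delbar on components *)

Section Dolbeault.
Variables (R : realType) (n : nat) (T : topologicalType) (X : complex_structure R n T).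

Lemma form_proj_eq0 k p (a : cform R (n + n) T k) :
  (forall x A S, typed A S -> #|S| = p -> a x A = 0) -> form_proj p a = form0.
Proof. by move=> h; apply/funext => x; exact: covec_proj0 (h x). Qed.

Lemma form_proj_ext k p (a b : cform R (n + n) T k) :
  (forall x A S, typed A S -> #|S| = p -> a x A = b x A) ->
  form_proj p a = form_proj p b.
Proof. by move=> h; apply/funext => x; exact: covec_proj_ext (h x). Qed.

Lemma form_projK k p q (a : cform R (n + n) T k) : smooth_form X a ->
  form_proj p (form_proj q a) = if p == q then form_proj q a else form0.
Proof.
move=> [a1 _]; case: eqP => [->|pq].
  apply: form_proj_ext => x A S hA hS.
  by rewrite /form_proj (covec_proj_typed _ (a1 x).1 hA) hS eqxx.
apply: form_proj_eq0 => x A S hA hS.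
rewrite /form_proj (covec_proj_typed _ (a1 x).1 hA) hS.
by case: eqP.
Qed.

Lemma form_proj_ext_d0 k p (a : cform R (n + n) T k) :
  a = form0 -> form_proj p (ext_d X a) = form0.
Proof.
move=> ->; rewrite (_ : ext_d X form0 = form0) ?form_proj0 //.
by apply/funext => x; apply/funext => A; exact: ext_d_form0.
Qed.

Lemma delbar_single k p (a : cform R (n + n) T k) : (p <= k)%N ->
  (forall p', p' != p -> form_proj p' a = form0) -> form_proj p a = a ->
  delbar X a = form_proj p (ext_d X a).
Proof.
move=> pk h0 h1; apply/funext => x; apply/funext => A; rewrite /delbar.
have pk' : (p < k.+1)%N by [].
rewrite (bigD1 (Ordinal pk')) //= h1 big1 ?addr0 // => p' hp'.
by rewrite form_proj_ext_d0 //; apply: h0.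
Qed.

Lemma delbar_form_proj k p (a : cform R (n + n) T k) : smooth_form X a ->
  (p <= k)%N -> delbar X (form_proj p a) = form_proj p (ext_d X (form_proj p a)).
Proof.
move=> sa pk; apply: delbar_single => // [p' pp|]; rewrite form_projK //.
  by rewrite (negPf pp).
by rewrite eqxx.
Qed.

(* The (N, k+1-N)-component of da = 0 reads del a^(N-1,.) + delbar a^(N,.) = 0. *)
Lemma del_delbar_cancel k N (a b : cform R (n + n) T k) : smooth_form X a ->
  (N <= k)%N -> ext_d X a = form0 ->
  (forall p, form_proj p b = if p.+1 == N then form_proj p a else form0) ->
  del X b = fun x A => - delbar X (form_proj N a) x A.
Proof.
move=> sa Nk da hb; apply/funext => x; apply/funext => A.
apply/eqP; rewrite -addr_eq0; apply/eqP; rewrite delbar_form_proj //.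
have -> : del X b x A = \sum_(S : {set 'I_k.+1} | #|S| == N)
    \sum_(p < k.+1 | p.+1 == N) ext_d X (form_proj p a) x (proj_rows S A).
  rewrite exchange_big /= [RHS]big_mkcond; apply: eq_bigr => p _.
  rewrite hb; case: eqP => [<-|_] //.
  by rewrite form_proj_ext_d0.
rewrite /form_proj covec_projE -big_split; apply: big1 => S /eqP hS.
have hB := proj_rows_typed S A; set B := proj_rows S A in hB *.
under eq_bigr => p _ do rewrite (typed_ext_d _ _ sa hB).
apply: etrans (congr1 (+%R _) (typed_ext_d N x sa hB)) _.
have d0 : ext_d X a x B = 0 by rewrite da.
apply: etrans _ d0; rewrite ext_dE /chart_d exchange_big -big_split /=.
apply: eq_bigr => i _; rewrite -mulr_sumr -mulrDr; apply: (congr2 *%R (erefl _)).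
set D := deriveC _ _ _; clearbody D; rewrite /row_card hS.
(* If row [i] has type (0,1), then [N] rows of type (1,0) remain and the term comes from delbar;
   otherwise [N - 1] remain and it comes from del, through the index p = [N - 1]. *)
case: (boolP (i \in S)) => iS; last first.
  rewrite subn0 eqxx big1 ?add0r // => p /eqP <-.
  by rewrite eqn_leq ltnn.
have N0 : (0 < N)%N by rewrite -hS; apply/card_gt0P; exists i.
have Nk' : (N.-1 < k.+1)%N by rewrite prednK // leqW.
rewrite subn1 (bigD1 (Ordinal Nk')) /= ?prednK // eqxx big1 ?addr0.
  by rewrite ltn_eqF ?addr0 // prednK.
by move=> p /andP[/eqP pN]; rewrite -val_eqE /= -pN /= eqxx.
Qed.

(** The result would take q + 1 > n arguments of type (0,1), which [alt_T01_eq0] forbids. *)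
Lemma delbar_top k p q (a : cform R (n + n) T k) : smooth_form X a ->
  (p + q = k)%N -> (forall x, covec_type p q (a x)) -> (n <= q)%N ->
  delbar X a = form0.
Proof.
move=> sa pqk ta nq.
have h0 p' : p' != p -> form_proj p' a = form0.
  move=> pp; apply: form_proj_eq0 => x A S hA hS; have [_ h] := ta x.
  by apply: (h A S hA) => e; rewrite -hS e eqxx in pp.
apply/funext => x; apply/funext => A; rewrite /delbar big1 // => p' _.
have [pp|pp] := eqVneq (p' : nat) p; last by rewrite form_proj_ext_d0 ?h0.
have sd := ext_d_smooth (form_proj_smooth p' sa).
rewrite [form_proj p' (ext_d _ _)]form_proj_eq0 // => y B S hB hS.
have [ml alt] := sd.1 y; apply: (alt_T01_eq0 ml alt (S := ~: S)).
  by move=> i; rewrite finset.in_setC => /negPf iS; have := hB i; rewrite iS.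
by rewrite cardsCs finset.setCK card_ord hS pp -pqk subSn ?leq_addr // addKn ltnS.
Qed.

End Dolbeault.

(** * The derivative at t = 0 of a smooth family of forms *)

Section TimeDerivative.
Variables (R : realType) (m : nat) (T : topologicalType) (S : smooth_atlas R m T).
Variables (eps : R).
Hypothesis eps0 : 0 < eps.
Local Notation I := (param_interval eps).
Local Notation RV := (R^o * 'rV[R]_m)%type.
Local Notation ch := (chart_at S).

Lemma param_interval0 : I 0.
Proof. by rewrite /param_interval /= oppr_lt0 eps0. Qed.

Lemma param_interval_open : open (I : set R^o).
Proof.
have -> : I = [set` `]- eps, eps[%R] by apply/seteqP; split => t; rewrite /= in_itv.
exact: interval_open.
Qed.

Lemma open_cylinder q : open (I `*` chart_im (ch q) : set RV).
Proof.
rewrite openE => -[t x] [/= It qx]; exists (I, chart_im (ch q)) => //=; split.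
  by apply: open_nbhs_nbhs; split => //; exact: param_interval_open.
by apply: open_nbhs_nbhs; split => //; exact: open_chart_im.
Qed.

Lemma near_param_interval (P : R^o -> Prop) : (forall t, I t -> P t) -> \forall t \near (0 : R^o), P t.
Proof.
move=> h; apply: filterS h _; apply: open_nbhs_nbhs; split; last exact: param_interval0.
exact: param_interval_open.
Qed.

(** Wedge powers commute with pullback ([E]), so in a chart the power is a polynomial in values of
    the local expression of [w]. *)
Lemma smooth_family_form_pow (w : R -> cform R m T 2) j :
  smooth_family_form S eps w -> smooth_family_form S eps (fun t => form_pow (w t) j).
Proof.
move=> sw q A; have oD : open (I `*` chart_im (ch q) : set RV) := @open_cylinder q.
set c := chart_at S q; have H B : smoothC_on (I `*` chart_im c)
    (fun tx : RV => wedge_pow (local_form S c (w tx.1) tx.2) j B).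
  elim: j {A} B => [|j IH] B; first exact: smoothC_on_cst.
  apply: (smoothC_on_scale _ oD); apply: (smoothC_on_sum _ oD) => s _.
  by apply: (smoothC_on_scale _ oD); exact: (smoothC_on_mul oD (sw q _) (IH _)).
have E (a : covec R m 2) (P : 'M[R[i]]_m) B :
    wedge_pow a j (B *m P) = wedge_pow (fun B => a (B *m P)) j B.
  elim: j {H A} B => [|j IH] B //=; rewrite /wedge_prod; apply: (congr2 *%R (erefl _)).
  apply: eq_bigr => s _; apply: (congr2 *%R (erefl _)).
  have -> : row_perm s (B *m P) = row_perm s B *m P by rewrite !row_permE mulmxA.
  by rewrite -mul_usub_mx -mul_dsub_mx IH.
by apply: (smoothC_on_congr oD _ (H A)) => -[t x] _ /=; rewrite -E.
Qed.

Variables (k : nat) (Om : R -> cform R m T k).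
Hypothesis Om_ml : forall t, I t -> forall p, multilinear (Om t p) /\ Defs.alternating (Om t p).
Hypothesis Om_smooth : smooth_family_form S eps Om.

Definition dform : cform R m T k := fun p A => derC (fun t : R^o => Om t p A) 1 0.

Lemma Om_differentiable p A : differentiableC (fun t : R^o => Om t p A) 0.
Proof.
have D0 : (I `*` chart_im (ch p)) ((0 : R^o), chart_coord (ch p) p).
  by split; [exact: param_interval0|exact: chart_imI (chart_at_dom S p)].
have := differentiableC_slice1 (smoothC_on_differentiableC (Om_smooth p A) D0).
by under eq_fun do rewrite /= local_form_at.
Qed.

Lemma dform_multilinear p : multilinear (dform p).
Proof.
apply: multilinearI => A i b b' v w; rewrite /dform.
have d B := Om_differentiable p B.
rewrite -(derC_scale _ _ (d _)) -(derC_scale _ _ (d _)) -derC_add; try exact: differentiableC_scale.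
apply: near_eq_derC; apply: near_param_interval => t It.
by apply: multilinear_setrow; case: (Om_ml It p).
Qed.

Lemma dform_alternating p : Defs.alternating (dform p).
Proof.
move=> A i j ij hA; apply: etrans _ (derC_cst 0 (1 : R^o) 0).
apply: near_eq_derC; apply: near_param_interval => t It.
by have [_ alt] := Om_ml It p; exact: alt ij hA.
Qed.

(** The Jacobian in the local expression does not involve time, so the derivative in [t] is a
    directional derivative on the cylinder and inherits its smoothness. *)
Lemma local_dform q x A : chart_im (ch q) x -> local_form S (ch q) dform x A =
  derC (fun tx : RV => local_form S (ch q) (Om tx.1) tx.2 A) ((1, 0) : RV) (0, x).
Proof.
move=> qx; rewrite -derC_slice1 //.
have D0 : (I `*` chart_im (ch q)) ((0 : R^o), x) by split => //; exact: param_interval0.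
exact: smoothC_on_differentiableC (Om_smooth q A) D0.
Qed.

Lemma dform_smooth : smooth_form S dform.
Proof.
split; first by move=> p; split; [exact: dform_multilinear|exact: dform_alternating].
move=> q A /=; have oq := open_chart_im (ch q).
have H : smoothC_on (chart_im (ch q)) (fun x =>
  derC (fun tx : RV => local_form S (ch q) (Om tx.1) tx.2 A) ((1, 0) : RV) (0, x)).
  apply: (smoothC_on_slice (D := I `*` chart_im (ch q)) (t := 0) oq).
    by move=> x qx; split => //; exact: param_interval0.
  by apply: smoothC_on_derC; exact: Om_smooth.
by apply: (smoothC_on_congr oq _ H) => x qx; rewrite local_dform.
Qed.

(** Schwarz on the cylinder, in the directions (0, v) and (1, 0), exchanges the space and time
    derivatives ([swap]), and complex directions follow by linearity. The result is the time
    derivative of d([Om t]), which is 0 for [t] near 0. *)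
Lemma ext_d_dform : (forall t, I t -> ext_d S (Om t) = form0) -> ext_d S dform = form0.
Proof.
move=> Om_closed; apply/funext => p; apply/funext => A.
set c := ch p; set x := chart_coord c p.
have qx : chart_im c x := chart_imI (chart_at_dom S p).
have D0 : (I `*` chart_im c) ((0 : R^o), x) by split => //; exact: param_interval0.
have oD : open (I `*` chart_im (ch p) : set RV) := @open_cylinder p.
pose F i (tx : RV) := local_form S c (Om tx.1) tx.2 (row' i A).
have sF i : smoothC_on (I `*` chart_im c) (F i) by exact: Om_smooth.
have dF i (v : 'rV[R]_m) : differentiableC (derC (F i) ((0, v) : RV)) (0, x).
  exact: smoothC_on_differentiableC (smoothC_on_derC _ (sF i)) D0.
have swap i (v : 'rV[R]_m) : derC (fun y => local_form S c dform y (row' i A)) v x =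
    derC (fun t : R^o => derC (fun y => F i (t, y)) v x) 1 0.
  have E : \forall y \near x, derC (F i) ((1, 0) : RV) (0, y) = local_form S c dform y (row' i A).
    by apply: (near_open (open_chart_im c) qx) => y qy; rewrite local_dform.
  apply: etrans (esym (near_eq_derC v E)) _; rewrite derC_slice.
  apply: etrans (schwarzC _ _ oD (sF i) D0) _.
  rewrite -(derC_slice1 (dF i v)).
  by apply: near_eq_derC; apply: filterE => t; rewrite derC_slice.
have dt i (v : 'rV[R]_m) : differentiableC (fun t : R^o => derC (fun y => F i (t, y)) v x) 0.
  have := differentiableC_slice1 (dF i v).
  by apply: near_eq_differentiableC; apply: filterE => t; rewrite derC_slice.
pose G i w (t : R^o) := deriveC (fun y => F i (t, y)) w x.
have dG i w : differentiableC (G i w) 0.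
  exact: (differentiableC_add (dt _ _) (differentiableC_scale _ (dt _ _))).
have -> : ext_d S dform p A = derC (fun t : R^o => \sum_(i < k.+1) (-1) ^+ i * G i (row i A) t) 1 0.
  rewrite derC_sum; last by move=> i; exact: differentiableC_scale.
  apply: eq_bigr => i _; rewrite derC_scale //; apply: (congr2 *%R (erefl _)).
  rewrite /G deriveCE; apply: etrans _ (esym (derC_add _ (dt _ _) (differentiableC_scale _ (dt _ _)))).
  apply: (congr2 +%R); first exact: swap.
  apply: etrans _ (esym (derC_scale iC _ (dt _ _))).
  exact: (congr2 *%R (erefl _) (swap _ _)).
apply: etrans _ (derC_cst 0 (1 : R^o) 0).
apply: near_eq_derC; apply: near_param_interval => t It.
exact: (congr1 (fun f => f p A) (Om_closed t It)).
Qed.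

End TimeDerivative.

(** * Fundamental forms of Hermitian metrics *)

Lemma form_linearl (K : comPzRingType) m (M G : 'M[K]_m) b b' (u v w : 'rV_m) :
  ((b *: u + b' *: v) *m M *m G *m w^T) 0 0 =
  b * (u *m M *m G *m w^T) 0 0 + b' * (v *m M *m G *m w^T) 0 0.
Proof. by rewrite !mulmxDl -!scalemxAl !mxE. Qed.

Lemma form_linearr (K : comPzRingType) m (M G : 'M[K]_m) b b' (u v w : 'rV_m) :
  (w *m M *m G *m (b *: u + b' *: v)^T) 0 0 =
  b * (w *m M *m G *m u^T) 0 0 + b' * (w *m M *m G *m v^T) 0 0.
Proof. by rewrite linearD !linearZ /= mulmxDr -!scalemxAr !mxE. Qed.

Lemma ord2_cases (i : 'I_2) : i = 0 \/ i = 1.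
Proof. by case: i => -[|[|]] // ?; [left|right]; apply: val_inj. Qed.

Section Isotropic.
Variables (R : realType) (m : nat) (T : topologicalType).

Lemma bilinear_mx_eq (A B : 'M[R]_m) :
  (forall v w : 'rV_m, v *m A *m w^T = v *m B *m w^T) -> A = B.
Proof.
move=> h; apply: mulmx_row_inj => v; apply: trmx_inj; apply: mulmx_row_inj => w.
by apply: trmx_inj; rewrite !trmx_mul !trmxK h.
Qed.

(** Here [c] is i or -i. Since g is J-invariant, its value on two eigenvectors for [c] is multiplied
    by c^2 = -1 when J is applied to both, hence is 0. *)
Lemma fundamental_form_isotropic (J g : T -> 'M[R]_m) p (c : R[i]) (B : 'M[R[i]]_(2, m)) :
  (forall v w : 'rV[R]_m, (v *m J p) *m g p *m (w *m J p)^T = v *m g p *m w^T) ->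
  c * c = -1 ->
  (forall i, row i B *m cmx (J p) = c *: row i B) ->
  fundamental_form J g p B = 0.
Proof.
move=> hJ c2 hB.
have JgJ : J p *m g p *m (J p)^T = g p.
  apply: bilinear_mx_eq => v w; rewrite -hJ trmx_mul !mulmxA //.
have tr (A : 'M[R]_m) : (cmx A)^T = cmx A^T by rewrite !cmxE map_trmx.
rewrite /fundamental_form hB -!scalemxAl mxE.
set x := (_ *m _) 0 0; suff -> : x = 0 by rewrite mulr0.
apply: eq_oppr0; rewrite {1}/x -{1}JgJ !cmxM -tr.
have -> : row 0 B *m (cmx (J p) *m cmx (g p) *m (cmx (J p))^T) *m (row 1 B)^T =
  (row 0 B *m cmx (J p)) *m cmx (g p) *m (row 1 B *m cmx (J p))^T.
  by rewrite trmx_mul !mulmxA.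
by rewrite !hB linearZ /= -!scalemxAl -scalemxAr scalerA c2 scaleN1r mxE.
Qed.

Lemma fundamental_form_multilinear (J g : T -> 'M[R]_m) p :
  multilinear (fundamental_form J g p).
Proof.
apply: multilinearI => A i b b' v w; rewrite /fundamental_form.
set M := cmx (J p); set G := cmx (g p).
case: (ord2_cases i) => ->; rewrite !row_setrow /= ?eqxx.
  exact: form_linearl.
exact: form_linearr.
Qed.

End Isotropic.

(** * Vectors of type (0,1) for a deformed structure *)

Section DeformedType.
Variables (R : realType) (n : nat) (T : topologicalType) (X X' : complex_structure R n T).
Variables (psi : vector_form R n T).
Hypothesis same : same_smooth_structure X X'.
Hypothesis psi_vf : is_vector_form X psi.
Hypothesis holo : forall (U : set T) (f : T -> R[i]), open U -> holo_fun X' U f ->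
  forall p, U p -> forall A, delbar X (form_of_fun f) p A -
    form_contraction psi (del X (form_of_fun f : cform R (n + n) T 0)) p A = 0.

(** The coordinates f of [X'] around [p] satisfy the equation of [holo], which says df(v) = df(v
    psi). So the Jacobian towards the chart of [X'] maps v - v psi to a vector killed by every dz_k,
    and [almost_cplx] is [Jstd] conjugated by this Jacobian. *)
Lemma deformed_T01 p v : T01 v ->
  (v - v *m psi p) *m cmx (almost_cplx X X' p) = - iC *: (v - v *m psi p).
Proof.
move=> hv; set w := v - _.
pose c := chart_at X p; pose c' := chart_at X' p; pose x := chart_coord c p.
have pc : chart_dom c p := chart_at_dom X p.
have pc' : chart_dom c' p := chart_at_dom X' p.
have invx : chart_inv c x = p := chart_coordK pc.
have xo : chart_overlap c c' x.
  by apply/chart_overlapE; rewrite invx; split => //; exact: chart_imI.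
have d1 : differentiable (transition c c') x.
  exact: smooth_transition_differentiable (same p p).1 xo.
have tx : transition c c' x = chart_coord c' p by rewrite /transition invx.
have d2 : differentiable (transition c' c) (transition c c' x).
  exact: smooth_transition_differentiable (same p p).2 (transition_overlap xo).
have inv : jac c c' x *m jac c' c (chart_coord c' p) = 1%:M.
  rewrite -tx -(jac_chain xo d1 d2).2 jac_id //; exact: chart_imI.
suff h : T01 (w *m cmx (jac c c' x)).
  rewrite /almost_cplx -/c -/c' -/x !cmxM !mulmxA h -scalemxAl -mulmxA -cmxM inv.
  by rewrite cmx1 mulmx1.
apply: T01_dz => k; rewrite -(deriveC_zcoord d1); set z := zcoord c c' k.
have dz := zcoord_differentiable d1 k.
pose f y := Complex (chart_coord c' y 0 (lshift n k)) (chart_coord c' y 0 (rshift n k)).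
pose F : cform R (n + n) T 0 := form_of_fun f.
have F0 : form_proj 0 F = F.
  apply/funext => y; apply/funext => A; rewrite /form_proj covec_projE.
  rewrite (big_pred1 finset.set0) // => S; exact: cards_eq0.
pose G : covec R (n + n) 1 := fun A => deriveC z (row 0 A) x.
have dF : ext_d X F p = G.
  by apply/funext => A; rewrite /ext_d big_ord1 expr0 mul1r.
have Gml : multilinear G.
  apply: multilinearI => A i b b' u u'; rewrite (ord1 i) /G !row_setrow eqxx.
  exact: deriveC_comb.
have Galt : Defs.alternating G by move=> A i j; rewrite (ord1 i) (ord1 j).
have hf : holo_fun X' (chart_dom c') f by move=> q; exact: (trans_holo X' q p k).
have := holo (chart_dom_open c') hf pc' v.
have -> : delbar X (form_of_fun f) p v = covec_proj 0 G v.
  by rewrite /delbar big_ord1 F0 /form_proj dF.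
have -> : form_contraction psi (del X F) p v = covec_contraction (psi p) (covec_proj 1 G) v.
  rewrite /form_contraction; congr (covec_contraction _ _ _); apply/funext => A.
  by rewrite /del big_ord1 F0 /form_proj dF.
have rowv (u : 'rV[R[i]]_(n + n)) i : row i u = u.
  by apply/rowP => j; rewrite mxE (ord1 i).
have tv : typed v finset.set0 by move=> i; rewrite finset.in_set0 rowv.
have tpsi : typed (setrow v 0 (v *m psi p)) finset.setT.
  move=> i; rewrite finset.in_setT (ord1 i) row_setrow eqxx.
  by case: (psi_vf.1 p v).
(* On [v] the (0,1)-part of df takes the value df(v); the contracted (1,0)-part takes the value df(v
   psi), since v psi has type (1,0). *)
rewrite covec_contractionE.
- rewrite big_ord1 rowv (covec_proj_typed _ Gml tv) (covec_proj_typed _ Gml tpsi).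
  rewrite finset.cards0 finset.cardsT card_ord /= /G rowv row_setrow eqxx => e.
  have := deriveC_comb 1 (-1) v (v *m psi p) dz.
  by rewrite mul1r mulN1r e scale1r scaleN1r.
- exact: covec_proj_multilinear.
- exact: covec_proj_alternating.
- by move=> u hu; case: (psi_vf.1 p u) => h _; exact: h.
Qed.

End DeformedType.

(** * Curves of complex matrices *)

Section MatrixDerivative.
Variables (R : realType).

Definition derMx a b (F : R^o -> 'M[R[i]]_(a, b)) : 'M[R[i]]_(a, b) :=
  \matrix_(i, j) derC (fun t => F t i j) 1 0.

Definition differentiableMx a b (F : R^o -> 'M[R[i]]_(a, b)) : Prop :=
  forall i j, differentiableC (fun t => F t i j) 0.

Lemma differentiable_mulmxr a b c (F : R^o -> 'M[R[i]]_(a, b)) (P : 'M[R[i]]_(b, c)) :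
  differentiableMx F -> differentiableMx (fun t => F t *m P) /\
  derMx (fun t => F t *m P) = derMx F *m P.
Proof.
move=> dF; have d i j l : differentiableC (fun t : R^o => P l j * F t i l) 0.
  exact: differentiableC_scale.
have E i j : (fun t => (F t *m P) i j) = fun t => \sum_l P l j * F t i l.
  by apply/funext => t; rewrite mxE; apply: eq_bigr => l _; rewrite mulrC.
split => [i j|]; first by rewrite E; exact: differentiableC_sum.
apply/matrixP => i j; rewrite !mxE E derC_sum //; apply: eq_bigr => l _.
by rewrite derC_scale // mxE mulrC.
Qed.

Lemma differentiable_mulmxl a b c (F : R^o -> 'M[R[i]]_(a, b)) (P : 'M[R[i]]_(c, a)) :
  differentiableMx F -> differentiableMx (fun t => P *m F t) /\
  derMx (fun t => P *m F t) = P *m derMx F.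
Proof.
move=> dF; have d i j l : differentiableC (fun t : R^o => P i l * F t l j) 0.
  exact: differentiableC_scale.
have E i j : (fun t => (P *m F t) i j) = fun t => \sum_l P i l * F t l j.
  by apply/funext => t; rewrite mxE.
split => [i j|]; first by rewrite E; exact: differentiableC_sum.
apply/matrixP => i j; rewrite !mxE E derC_sum //; apply: eq_bigr => l _.
by rewrite derC_scale // mxE.
Qed.

Lemma near_eq_derMx a b (F G : R^o -> 'M[R[i]]_(a, b)) :
  (\forall t \near 0, F t = G t) -> derMx F = derMx G.
Proof.
move=> FG; apply/matrixP => i j; rewrite !mxE; apply: near_eq_derC.
by apply: filterS FG => t ->.
Qed.

End MatrixDerivative.

(** * The first variation of the power of the fundamental form *)

Section Variation.
Variables (R : realType) (n : nat) (T : topologicalType) (X : complex_structure R n T).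
Variables (g : T -> 'M[R]_(n + n)) (eps : R).
Variables (Xt : R -> complex_structure R n T) (phi : R -> vector_form R n T).
Variables (wt : R -> cform R (n + n) T 2).
Hypothesis g_hermitian : hermitian_metric X (fun=> Jstd) g.
Hypothesis eps_gt0 : 0 < eps.
Hypothesis Xt_deformation : deformation X eps Xt.
Hypothesis Xt_phi : parametrized_by X eps Xt phi.
Hypothesis wt_balanced : balanced_family X eps Xt wt.
Hypothesis wt0 : wt 0 = fundamental_form (fun=> Jstd) g.

Local Notation I := (param_interval eps).
Local Notation N := n.-1.
Local Notation Om t := (form_pow (wt t) N).
Local Notation J := (cmx (@Jstd R n)).
Local Notation phi' := (dphi0 phi).

Lemma phi_differentiable p : differentiableMx (fun t => phi t p).
Proof.
move=> i j; have [_ sphi _ _ _] := Xt_phi.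
have hp := chart_at_dom X p; have hx := chart_imI hp.
have D0 : (I `*` chart_im (chart_at X p)) ((0 : R^o), chart_coord (chart_at X p) p).
  by split => //; exact: param_interval0.
have := differentiableC_slice1 (smoothC_on_differentiableC (sphi p i j) D0).
have E t : local_vf X (chart_at X p) (phi t) (chart_coord (chart_at X p) p) = phi t p.
  by rewrite /local_vf (chart_coordK hp) (jac_id hx) cmx1 mul1mx mulmx1.
by under eq_fun do rewrite /= E.
Qed.

Lemma dphi0E p : phi' p = derMx (fun t => phi t p).
Proof. by apply/matrixP => i j; rewrite !mxE !derive1E. Qed.

Lemma phi_vf t : I t -> is_vector_form X (phi t).
Proof. by have [h _ _ _ _] := Xt_phi; exact: h. Qed.

(** The pointwise conditions on a (0,1)-vector form are linear, so they pass from [phi t] to its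
    derivative; the same holds for [dphi0_in_T10]. *)
Lemma dphi0_T10 p v : T10 v -> v *m phi' p = 0.
Proof.
move=> hv; have [_ E] := differentiable_mulmxl v (@phi_differentiable p).
rewrite dphi0E -E (@near_eq_derMx _ _ _ _ (fun=> 0)).
  by apply/matrixP => i j; rewrite !mxE; exact: derC_cst.
apply: (near_param_interval eps_gt0) => t It.
by have [h _] := (phi_vf It).1 p v; exact: h.
Qed.

Lemma dphi0_in_T10 p v : T10 (v *m phi' p).
Proof.
have [d1 E1] := differentiable_mulmxl v (@phi_differentiable p).
have [_ E2] := differentiable_mulmxr J d1.
have [_ E3] := differentiable_mulmxr (iC%:M : 'M[R[i]]_(n + n)) d1.
rewrite /T10 dphi0E -E1 -E2 -mul_mx_scalar -E3; apply: near_eq_derMx.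
apply: (near_param_interval eps_gt0) => t It.
by have [_ h] := (phi_vf It).1 p v; rewrite mul_mx_scalar; exact: h.
Qed.

Lemma Om_fundamental t : I t -> exists2 gt, balanced_metric X (almost_cplx X (Xt t)) gt &
  wt t = fundamental_form (almost_cplx X (Xt t)) gt.
Proof. by have [_ h] := wt_balanced; exact: h. Qed.

Lemma Om_multilinear_alternating t : I t ->
  forall p, multilinear (Om t p) /\ Defs.alternating (Om t p).
Proof.
move=> It p; have [gt _ ->] := Om_fundamental It; split; last exact: wedge_pow_alternating.
by apply: wedge_pow_multilinear; exact: fundamental_form_multilinear.
Qed.

Lemma Om_isotropic t p A (S : {set 'I_N.*2}) : I t -> (N < #|S|)%N ->
  (forall i, i \in S -> row i A *m cmx (almost_cplx X (Xt t) p) = - iC *: row i A) ->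
  Om t p A = 0.
Proof.
move=> It NS hS; have [gt [[_ _ _ hJ] _] ->] := Om_fundamental It.
apply: (wedge_pow_isotropic
  (L := fun v => v *m cmx (almost_cplx X (Xt t) p) = - iC *: v) _ hS NS) => B h0 h1.
apply: (fundamental_form_isotropic (c := - iC)) => //; first by rewrite mulrNN iC2.
by move=> i; have [->|->] := ord2_cases i.
Qed.

(** With [c] = i and [c] = -i, this says that $\omega^{n-1}$ has type (N, N) for X: it vanishes on
    more than [N] arguments of one type. *)
Lemma Om0_isotropic p A (S : {set 'I_N.*2}) (c : R[i]) : c * c = -1 ->
  (N < #|S|)%N -> (forall i, i \in S -> row i A *m J = c *: row i A) -> Om 0 p A = 0.
Proof.
move=> c2 NS hS; have [_ _ _ hJ] := g_hermitian; rewrite wt0.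
apply: (wedge_pow_isotropic (L := fun v => v *m J = c *: v) _ hS NS) => B h0 h1.
apply: (fundamental_form_isotropic (c := c)) => //.
by move=> i; have [->|->] := ord2_cases i.
Qed.

Definition dOm : cform R (n + n) T N.*2 := dform (fun t => Om t).
Local Notation beta := (form_contraction phi' (Om 0)).

Lemma betaE p A : beta p A = \sum_i Om 0 p (setrow A i (row i A *m phi' p)).
Proof.
have [ml alt] := Om_multilinear_alternating (param_interval0 eps_gt0) p.
by apply: covec_contractionE => // v; exact: dphi0_T10.
Qed.

Lemma Om_smooth : smooth_family_form X eps (fun t => Om t).
Proof. by apply: smooth_family_form_pow; case: wt_balanced. Qed.

Lemma dOm_smooth : smooth_form X dOm.
Proof. exact: (dform_smooth eps_gt0 (@Om_multilinear_alternating) Om_smooth). Qed.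

Lemma dOm_closed : ext_d X dOm = form0.
Proof.
apply: (ext_d_dform eps_gt0 Om_smooth) => t It.
by have [gt [_ cl] ->] := Om_fundamental It.
Qed.

(* Omega_t vanishes when more than N of its arguments are of type (0,1) for X_t,
   i.e. of the form v - phi_t v with v of type (0,1) for X; differentiate at t = 0. *)
Lemma dOm_beta p A (S : {set 'I_N.*2}) : (N < #|S|)%N ->
  (forall i, i \in S -> T01 (row i A)) -> dOm p A = beta p A.
Proof.
move=> NS hS; have [_ _ phi0 _ holo] := Xt_phi.
have [dphi dphiE] := differentiable_mulmxl A (@phi_differentiable p).
(* Rows of [A] of type (0,1) for X become rows of type (0,1) for [Xt t], so $\Omega_t$ vanishes on
   [B t] for all small [t]. *)
pose B (t : R^o) := A - A *m phi t p.
have Bij i j : (fun t => B t i j) = fun t => A i j + (-1) * (A *m phi t p) i j.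
  by apply/funext => t; rewrite mxE [X in _ + X]mxE mulN1r.
have dB i j : differentiableC (fun t => B t i j) 0.
  rewrite Bij; apply: differentiableC_add; first exact: differentiableC_cst.
  exact: differentiableC_scale.
have B'ij i j : derC (fun t => B t i j) 1 0 = - (A *m phi' p) i j.
  rewrite Bij derC_add; [|exact: differentiableC_cst|exact: differentiableC_scale].
  by rewrite derC_cst add0r derC_scale // mulN1r dphi0E -dphiE mxE.
have B0 : B 0 = A by rewrite /B phi0 mulmx0 subr0.
have ml : \forall t \near (0 : R^o), multilinear (Om t p).
  by apply: (near_param_interval eps_gt0) => t It; have [] := Om_multilinear_alternating It p.
have dOm0 E := Om_differentiable eps_gt0 Om_smooth p E.
have [_ H] := derC_multilinear ml dOm0 dB.
have H0 : derC (fun t : R^o => Om t p (B t)) 1 0 = 0.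
  apply: etrans _ (derC_cst 0 (1 : R^o) 0); apply: near_eq_derC.
  apply: (near_param_interval eps_gt0) => t It; apply: (Om_isotropic It NS) => i iS.
  have -> : row i (B t) = row i A - row i A *m phi t p.
    by rewrite /B -row_mul; apply/rowP => j; rewrite !mxE.
  apply: (deformed_T01 _ (phi_vf It)); last exact: hS.
    exact: Xt_deformation.1.
  by move=> U f oU hf; have /= [+ _] := holo t It U f oU => /(_ hf)[].
(* [e] is the product rule at t = 0: 0 is the sum of $\Omega'_0(A)$ and of the terms in which row
   [i] of [A] is replaced by its velocity, which is minus the image of this row under
   $\varphi'(0)$. *)
have e := etrans (esym H0) (H 1); clear H H0 Bij dB ml; clearbody B; rewrite B0 in e.
have -> : dOm p A = - \sum_i Om 0 p (setrow A i (\row_j derC (fun t => B t i j) 1 0)).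
  by apply/eqP; rewrite -addr_eq0; apply/eqP; exact: esym e.
rewrite betaE -sumrN; apply: eq_bigr => i _.
have [ml0 _] := Om_multilinear_alternating (param_interval0 eps_gt0) p.
have -> : \row_j derC (fun t => B t i j) 1 0 = (-1) *: (row i A *m phi' p).
  by apply/rowP => j; rewrite [LHS]mxE B'ij -row_mul !mxE mulN1r.
by rewrite ml_setrowZ // mulN1r opprK.
Qed.

(** The endomorphism $\varphi'(0)$ turns one argument of type (0,1) into one of type (1,0), and
    $\omega^{n-1}$ has type (N, N); so only p = N - 1 survives. There N + 1 arguments have type
    (0,1), just enough for [dOm_beta]. *)
Lemma beta_components p :
  form_proj p beta = if p.+1 == N then form_proj p dOm else form0.
Proof.
have T01C k (A : 'M[R[i]]_(k, n + n)) (S : {set 'I_k}) i : typed A S ->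
    i \in finset.setC S -> T01 (row i A).
  by move=> hA; rewrite finset.in_setC => /negPf iS; have := hA i; rewrite iS.
have cardC (S : {set 'I_N.*2}) : #|finset.setC S| = (N + N - #|S|)%N.
  by rewrite cardsCs finset.setCK card_ord addnn.
case: eqP => [pN|/eqP pN].
  apply: form_proj_ext => y A S hA hS; apply/esym.
  apply: (@dOm_beta _ _ (finset.setC S)) => [|i]; last exact: T01C.
  by rewrite cardC hS ltn_subRL ltn_add2r -pN.
apply: form_proj_eq0 => y A S hA hS; rewrite betaE; apply: big1 => i _.
have [ml0 _] := Om_multilinear_alternating (param_interval0 eps_gt0) y.
case: (boolP (i \in S)) => iS.
  by have := hA i; rewrite iS => /dphi0_T10 ->; rewrite ml_setrow0.
pose A' := setrow A i (row i A *m phi' y); pose S' := (i |: S)%SET.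
have hA' : typed A' S'.
  move=> l; rewrite row_setrow finset.in_setU1; case: eqP => _ /=.
    exact: dphi0_in_T10.
  exact: hA.
have cS' : #|S'| = p.+1 by rewrite cardsU1 iS hS.
(* After the replacement p + 1 rows have type (1,0): more than [N] of them, or else fewer than [N],
   and then more than [N] rows have type (0,1). *)
have [lt|le] := ltnP N p.+1.
  apply: (@Om0_isotropic y A' S' iC); [exact: iC2|by rewrite cS'|].
  by move=> l lS; have := hA' l; rewrite lS.
apply: (@Om0_isotropic y A' (finset.setC S') (- iC)).
- by rewrite mulrNN iC2.
- have lt : (p.+1 < N)%N by rewrite ltn_neqAle pN.
  by rewrite cardC cS' ltn_subRL ltn_add2r.
- by move=> l; exact: T01C.
Qed.

End Variation.

(** * Dolbeault classes and the conclusion *)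

Section FormZero.
Variables (R : realType) (n : nat) (T : topologicalType) (X : complex_structure R n T).

Lemma form0_smooth k : smooth_form X (form0 : cform R (n + n) T k).
Proof.
split; last by move=> q A /=; exact: smoothC_on_cst.
move=> y; split; last by [].
by apply: multilinearI => A i b b' v w; rewrite /form0 !mulr0 addr0.
Qed.

Lemma form0_Apq k p q : (p + q = k)%N -> Apq X p q (form0 : cform R (n + n) T k).
Proof. by move=> pq; split; [exact: form0_smooth|move=> x; split]. Qed.

Lemma form_proj_Apq k p (a : cform R (n + n) T k) : smooth_form X a ->
  (p <= k)%N -> Apq X p (k - p) (form_proj p a).
Proof.
move=> sa pk; split; first exact: form_proj_smooth.
by move=> x; apply: covec_proj_type => //; case: (sa.1 x).
Qed.

(** As a = - delbar c, subtracting [c] turns a primitive of b - a into a primitive of b, and adding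
    [c] goes back. A difference that is zero on the nose is given the primitive [form0]. *)
Lemma dolbeault_class_exact k p q (a : cform R (n + n) T k.+1) (c : cform R (n + n) T k) :
  (p + q.-1 = k)%N -> (0 < q)%N -> Apq X p q.-1 c ->
  a = (fun x A => - delbar X c x A) ->
  dolbeault_class X p q a = dolbeault_class X p q form0.
Proof.
move=> pq q0 hc ha; have h0 := form0_Apq pq.
have delbar_shift (b : cform R (n + n) T k) s : Apq X p q.-1 b ->
    delbar X (fun x A => b x A + s * c x A) = fun x A => delbar X b x A + s * delbar X c x A.
  by move=> hb; apply: delbar_comb; [exact: hb.1|exact: hc.1].
apply/seteqP; split => b [hb hab]; split => //; right.
- case: hab => [hab|[d [_ hd hdb]]].
    exists (fun x A => form0 x A + (-1) * c x A); split => //; first exact: Apq_comb.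
    rewrite delbar_shift // delbar_form0; apply/funext => x; apply/funext => A.
    have /eqP := congr1 (fun f => f x A) hab; rewrite subr_eq0 => /eqP ->.
    by rewrite ha /form0 add0r mulN1r subr0.
  exists (fun x A => d x A + (-1) * c x A); split => //; first exact: Apq_comb.
  rewrite delbar_shift // hdb; apply/funext => x; apply/funext => A.
  by rewrite ha /form0 mulN1r opprK subr0 addrK.
- case: hab => [hab|[d [_ hd hdb]]].
    exists (fun x A => form0 x A + 1 * c x A); split => //; first exact: Apq_comb.
    rewrite delbar_shift // delbar_form0; apply/funext => x; apply/funext => A.
    have /eqP := congr1 (fun f => f x A) hab; rewrite subr_eq0 => /eqP ->.
    by rewrite ha /form0 !add0r mul1r opprK.
  exists (fun x A => d x A + 1 * c x A); split => //; first exact: Apq_comb.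
  rewrite delbar_shift // hdb; apply/funext => x; apply/funext => A.
  by rewrite ha /form0 mul1r opprK subr0.
Qed.

End FormZero.

Unset Implicit Arguments.

Theorem corollary1p2 (R : realType) (n : nat) (n_gt0 : (0 < n)%N)
  (T : topologicalType) (T_hausdorff : hausdorff_space T)
  (T_compact : compact [set: T]) (X : complex_structure R n T)
  (g : T -> 'M[R]_(n + n))
  (g_balanced : balanced_metric X (fun=> Jstd) g)
  (eps : R) (eps_gt0 : 0 < eps)
  (Xt : R -> complex_structure R n T)
  (Xt_deformation : deformation X eps Xt)
  (phi : R -> vector_form R n T)
  (Xt_phi : parametrized_by X eps Xt phi) :
  let omega := fundamental_form (fun=> Jstd) g in
  (exists wt : R -> cform R (n + n) T 2,
     balanced_family X eps Xt wt /\ wt 0 = omega) ->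
  let a := del X (form_contraction (dphi0 phi) (form_pow omega n.-1)) in
  dolbeault_cocycle X n.-1 n a /\
  dolbeault_class X n.-1 n a = dolbeault_class X n.-1 n form0.
Proof.
move=> omega [wt [wt_balanced wt0]] a.
have NN : (n.-1 <= n.-1.*2)%N by rewrite -addnn leq_addr.
have sdOm := dOm_smooth eps_gt0 wt_balanced.
pose c := form_proj n.-1 (dOm wt).
have sc : smooth_form X c by exact: form_proj_smooth.
have ha : a = fun x A => - delbar X c x A.
  rewrite /a -wt0; apply: (del_delbar_cancel sdOm NN).
    exact: dOm_closed eps_gt0 wt_balanced.
  by move=> p; apply: (beta_components g_balanced.1 eps_gt0 Xt_deformation Xt_phi wt_balanced wt0).
have hc : Apq X n.-1 n.-1 c.
  have e : (n.-1.*2 - n.-1 = n.-1)%N by rewrite -addnn addnK.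
  by have := form_proj_Apq sdOm NN; rewrite e.
have hdc : Apq X n.-1 n (delbar X c).
  rewrite delbar_form_proj //.
  have e : (n.-1.*2.+1 - n.-1 = n)%N by rewrite subSn // -addnn addnK prednK.
  by have := form_proj_Apq (ext_d_smooth sc) (leqW NN); rewrite e.
have hn : (n.-1 + n = n.-1.*2.+1)%N by rewrite -{2}(prednK n_gt0) addnS addnn.
(* The smoothness and the type of [a] are read off from its expression as - delbar c. *)
have haA : Apq X n.-1 n a.
  have -> : a = fun x A => form0 x A + (-1) * delbar X c x A.
    by rewrite ha; apply/funext => x; apply/funext => A; rewrite /form0 add0r mulN1r.
  by apply: Apq_comb => //; exact: form0_Apq.
split; last by apply: (dolbeault_class_exact _ n_gt0 hc ha); rewrite addnn.
split => //; exact: (delbar_top haA.1 hn haA.2 (leqnn n)).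
Qed.
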